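(* Let $b>0$, $B>0$, $L_\infty>0$, and let $s\in\{1,\dots,d\}$. Suppose that $\psi$ is $M$-smooth on $\mathbb{R}$ and $m$-strongly convex on $[-b,b]$ with $m>0$. In addition, suppose that $\theta^\star$ is $s$-sparse, $\|\theta^\star\|_2\le B$ and $\max_{t\ge1}\|X_t\|_\infty\le L_\infty$. Let $q_1,q_2,\dots$ be the sequence of distributions played by the exponentially weighted average (EWA) forecaster with learning rate $\lambda=1/2$ and the prior $q_1=\sum_{S\subseteq[d]}\pi(S)q_S$, where $q_S$ is built from $\rho(\theta)=\|\theta\|_2^2/(2B^2)$. Let $\widehat Y_t=\int[\langle\theta,X_t\rangle]_b\,\mathrm{d}q_{t+1}(\theta)$. For $\delta\in(0,1)$ and $n\ge1$ define $$\beta_n=\frac{4s}{m}\log\frac{2ed\sqrt{1+MB^2L_\infty^2n/2}}{s}+\frac4m\log\frac{2\sqrt e}{\delta},\qquad \Theta_n=\Big\{\theta\in\mathbb{R}^d:\ \frac12\sum_{t=1}^n\big(\langle\theta,X_t\rangle-\widehat Y_t\big)^2\le\beta_n\Big\}.$$ Then $(\Theta_n)_{n\ge1}$ is a $1-\delta$ confidence sequence for $\theta^\star$, i.e. $\mathbb{P}[\exists n\ge1:\ \theta^\star\notin\Theta_n]\le\delta$.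
   Context: Generalized linear model (GLM). Fix $d\ge1$. Labels take values in a measurable set $\mathcal{Y}\subseteq\mathbb{R}$ equipped with a fixed $\sigma$-finite reference measure $\mathrm{d}y$ (e.g. Lebesgue or counting measure); all densities on $\mathcal{Y}$ are with respect to it. Let $h:\mathcal{Y}\to[0,\infty)$ and let $\psi:\mathbb{R}\to\mathbb{R}$ be convex and differentiable, such that for all $x,\theta\in\mathbb{R}^d$ the function $p(y|x,\theta)=\exp(\langle\theta,x\rangle y-\psi(\langle\theta,x\rangle))h(y)$ is a probability density on $\mathcal{Y}$. The data are random pairs $(X_t,Y_t)_{t\ge1}$ with $X_t\in\mathbb{R}^d$, $Y_t\in\mathcal{Y}$; let $\mathcal{F}_t=\sigma(X_1,Y_1,\dots,X_t,Y_t,X_{t+1})$ and $\mathcal{F}_0=\sigma(X_1)$. Covariates may be chosen adaptively, i.e. each $X_t$ may depend arbitrarily on the previous observations $(X_k,Y_k)_{k<t}$. For a fixed unknown $\theta^\star\in\mathbb{R}^d$ and every $t\ge 1$, the conditional density of $Y_t$ given $\mathcal{F}_{t-1}$ is $p(\cdot|X_t,\theta^\star)$. $\psi$ is $M$-smooth ($M>0$) if it is twice differentiable with $\psi''(z)\le M$ for all $z\in\mathbb{R}$, and $m$-strongly convex on $[-b,b]$ if $\psi''(z)\ge m$ for all $z\in[-b,b]$. $\theta^\star$ is $s$-sparse if exactly $s$ of its coordinates are nonzero. Loss: $\ell_t(\theta)=-\langle\theta,X_t\rangle Y_t+\psi(\langle\theta,X_t\rangle)-\log h(Y_t)=-\log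 p(Y_t|X_t,\theta)$. Truncation: $[z]_b=\max\{\min\{z,b\},-b\}$. EWA forecaster with learning rate $\lambda>0$ and prior $q_1$ (a probability distribution on $\mathbb{R}^d$): for $t\ge2$, $\frac{\mathrm{d}q_t}{\mathrm{d}q_1}(\theta)=\frac{e^{-\lambda\sum_{k=1}^{t-1}\ell_k(\theta)}}{\int e^{-\lambda\sum_{k=1}^{t-1}\ell_k}\,\mathrm{d}q_1}$. Subset-selection prior: $[d]=\{1,\dots,d\}$; for $S\subseteq[d]$, $\pi(S)=\frac{2^{-|S|}}{\binom{d}{|S|}\sum_{k=0}^d2^{-k}}$; $\Theta_S=\{\theta\in\mathbb{R}^d:\mathrm{supp}(\theta)\subseteq S\}$; $q_S$ is the probability measure supported on $\Theta_S$ whose density with respect to the ($|S|$-dimensional) Lebesgue measure on $\Theta_S$ is $e^{-\rho(\theta)}/\int_{\Theta_S}e^{-\rho(\theta')}\mathrm{d}\theta'$ (for $S=\emptyset$, the Dirac mass at $0$).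
   Formalization: The formal theorem additionally assumes that almost surely |⟨θ*,X_t⟩| ≤ b for all t ≥ 1; without it the claim is false (e.g. logistic model, X_t=1, θ*=B=10, b=1). *)

(* Defs.v *)
From HB Require Import structures.
From mathcomp Require Import all_boot all_order all_algebra.
From mathcomp Require Import all_classical all_reals all_analysis.

Set Implicit Arguments.
Unset Strict Implicit.
Unset Printing Implicit Defensive.

Import Order.TTheory GRing.Theory Num.Theory.
Import numFieldNormedType.Exports.

Local Open Scope classical_set_scope.
Local Open Scope ring_scope.

(** R^n is represented by [n.-tuple R], which carries the product sigma-algebra
    of the Borel sigma-algebra of R. *)

Section euclidean.
Context {R : realType}.

Definition dotp n (u v : n.-tuple R) : R :=
  \sum_(i < n) tnth u i * tnth v i.

Definition norm2 n (u : n.-tuple R) : R := Num.sqrt (dotp u u).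

Definition norm_oo n (u : n.-tuple R) : R :=
  \big[Num.max/0]_(i < n) `|tnth u i|.

Definition supp n (u : n.-tuple R) : {set 'I_n} :=
  [set i | tnth u i != 0]%SET.

Definition sparse n (s : nat) (u : n.-tuple R) : Prop := #|supp u| = s.

Definition trunc (b z : R) : R := Num.max (Num.min z b) (- b).

(** n-dimensional Lebesgue measure, as the n-fold product of the
    one-dimensional one. *)
Fixpoint lebesgue_tuple n : set (n.-tuple R) -> \bar R :=
  match n with
  | 0 => \d_([tuple] : 0.-tuple R)
  | n'.+1 =>
      pushforward (@lebesgue_measure R \x @lebesgue_tuple n')%E
        (fun p : R * n'.-tuple R => [tuple of p.1 :: p.2])
  end.

(** The linear isometry of R^|S| onto Theta_S = [set u | supp u \subset S]
    which puts the coordinates of [v], in order, at the positions in [S]. *)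
Definition embed_coords n (S : {set 'I_n}) (v : #|S|.-tuple R) : n.-tuple R :=
  [tuple if i \in S then nth 0 v (index i (enum S)) else 0 | i < n].

(** |S|-dimensional Lebesgue measure on Theta_S, as a measure on R^n; for
    S = set0 this is the Dirac mass at 0. *)
Definition lebesgue_coords n (S : {set 'I_n}) : set (n.-tuple R) -> \bar R :=
  pushforward (@lebesgue_tuple #|S|) (@embed_coords n S).

End euclidean.

(** The probability measure whose density with respect to [mu] is
    [f / \int f dmu], for [f >= 0] with [0 < \int f dmu < +oo]. *)
Definition normalized_density {d} {T : measurableType d} {R : realType}
    (mu : set T -> \bar R) (f : T -> R) : set T -> \bar R :=
  fun A => ((\int[mu]_(x in A) (f x)%:E) / (\int[mu]_x (f x)%:E))%E.

Section prior.
Context {R : realType}.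

Definition subset_weight d (S : {set 'I_d}) : R :=
  2 ^- #|S| / ('C(d, #|S|)%:R * \sum_(0 <= k < d.+1) 2 ^- k).

Definition subset_prior d (rho : d.-tuple R -> R) :
    set (d.-tuple R) -> \bar R :=
  fun A => (\sum_(S : {set 'I_d}) (subset_weight S)%:E *
    normalized_density (lebesgue_coords S) (fun u => expR (- rho u)%R) A)%E.

End prior.

(** For t >= 2, the distribution q_t of the exponentially weighted average
    forecaster with learning rate [lambda], prior [q1] and losses
    [l 1], [l 2], and so on; at t = 1 the sum is empty and this is [q1]. *)
Definition ewa {d} {T : measurableType d} {R : realType} (lambda : R)
    (q1 : set T -> \bar R) (l : nat -> T -> R) (t : nat) : set T -> \bar R :=
  normalized_density q1
    (fun u => expR (- lambda * \sum_(1 <= k < t) l k u)).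

Section glm.
Context {R : realType}.

Definition smooth (M : R) (psi : R -> R) : Prop :=
  forall z, [/\ derivable psi z 1, derivable (derive1 psi) z 1 & derive1n 2 psi z <= M].

Definition strongly_convex_on (D : set R) (m : R) (psi : R -> R) : Prop :=
  forall z, D z -> m <= derive1n 2 psi z.

Definition probability_density (nu : set R -> \bar R) (D : set R)
    (f : R -> R) : Prop :=
  [/\ measurable_fun D f, forall y, D y -> 0 <= f y &
      (\int[nu]_(y in D) (f y)%:E = 1)%E].

Definition glm_density d (psi h : R -> R) (x theta : d.-tuple R) (y : R) : R :=
  expR (dotp theta x * y - psi (dotp theta x)) * h y.

(** Here [ln 0 = 0]; a value [h y = 0] has probability 0 under the model, and
    the term [ln (h y)] does not depend on [theta]. *)
Definition glm_loss d (psi h : R -> R) (x : d.-tuple R) (y : R)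
    (theta : d.-tuple R) : R :=
  - dotp theta x * y + psi (dotp theta x) - ln (h y).

End glm.

Section process.
Context {R : realType} {dO : measure_display} {Omega : measurableType dO}.
Variables (P : probability Omega R) (d : nat).
Variables (X : nat -> {RV P >-> d.-tuple R}) (Y : nat -> {RV P >-> R}).

(** F_t = sigma(X_1, Y_1, ..., X_t, Y_t, X_{t+1}) *)
Definition history (t : nat) : set (set Omega) :=
  <<s [set A | (exists k B, [/\ (1 <= k <= t.+1)%N, measurable B &
                                A = X k @^-1` B]) \/
               (exists k C, [/\ (1 <= k <= t)%N, measurable C &
                                A = Y k @^-1` C])] >>.

(** [f w] is, for [w] in [Omega], the density on [D] with respect to [nu] of
    the conditional distribution of [Z] given the sub-sigma-algebra [F]. *)
Definition conditional_density (F : set (set Omega)) (nu : set R -> \bar R)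
    (D : set R) (Z : {RV P >-> R}) (f : Omega -> R -> R) : Prop :=
  forall A C, F A -> measurable C ->
    (P (A `&` Z @^-1` C) =
     \int[P]_(w in A) \int[nu]_(y in D `&` C) (f w y)%:E)%E.

(** A sequence of random sets which, with probability at least [1 - delta],
    all contain [u]. *)
Definition confidence_sequence (delta : R)
    (Theta : nat -> Omega -> set (d.-tuple R)) (u : d.-tuple R) : Prop :=
  (P [set w | exists n, (1 <= n)%N /\ ~ Theta n w u] <= delta%:E)%E.

End process.

Section subset_selection.
Context {R : realType} {dO : measure_display} {Omega : measurableType dO}.
Variables (P : probability Omega R) (d : nat).
Variables (X : nat -> {RV P >-> d.-tuple R}) (Y : nat -> {RV P >-> R}).
Variables (psi h : R -> R).

(** The distribution q_t played by the forecaster, along the outcome [w]. *)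
Definition glm_ewa (lambda B : R) (t : nat) (w : Omega) :
    set (d.-tuple R) -> \bar R :=
  ewa lambda (subset_prior (fun u => norm2 u ^+ 2 / (2 * B ^+ 2)))
    (fun k => glm_loss psi h (X k w) (Y k w)) t.

Definition Yhat (B b : R) (t : nat) (w : Omega) : R :=
  fine (\int[glm_ewa 2^-1 B t.+1 w]_u (trunc b (dotp u (X t w)))%:E)%E.

Definition beta (s : nat) (m M B Loo delta : R) (n : nat) : R :=
  4 * s%:R / m * ln (2 * expR 1 * d%:R *
                     Num.sqrt (1 + M * B ^+ 2 * Loo ^+ 2 * n%:R / 2) / s%:R) +
  4 / m * ln (2 * Num.sqrt (expR 1) / delta).

Definition conf_set (s : nat) (m M B b Loo delta : R) (n : nat) (w : Omega) :
    set (d.-tuple R) :=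
  [set u | 2^-1 * \sum_(1 <= t < n.+1) (dotp u (X t w) - Yhat B b t w) ^+ 2
             <= beta s m M B Loo delta n].

End subset_selection.

(* Main.v *)
Require Import Defs.
From HB Require Import structures.
From mathcomp Require Import all_boot all_order all_algebra.
From mathcomp Require Import all_classical all_reals all_analysis.
From mathcomp Require Import measurable_realfun.
From mathcomp Require Import ring lra.

(** Write z(u) = <u, X_t>, clipped to [-b, b] as in the forecast, and let W_n be
    the EWA weight at rate 1/2 relative to theta_star, i.e. the square root of the
    likelihood ratio of the first n observations, with I_n = \int W_n dq_1.
    For a single observation, the conditional expectation of the square root of
    the likelihood ratio is the exponential of minus a Jensen gap of psi, which by
    convexity and local strong convexity is at least m/8 (z(u) - z(theta_star))^2.
    Hence, conditionally on the past, the expectation of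
    \int W_n exp(m/8 (z - z(theta_star))^2) dq_1 is at most I_(n-1). Since
    W_n dq_1 = I_n dq_(n+1) and Yhat_n is the mean of z under q_(n+1), Jensen's
    inequality bounds that integral below by
    I_n exp(m/8 (Yhat_n - z(theta_star))^2). So
    I_n exp(m/8 \sum_(t <= n) (Yhat_t - <theta_star, X_t>)^2) is a
    supermartingale, and by Ville's inequality it stays below 1/delta with
    probability at least 1 - delta.

    It remains to bound I_n from below. Only the component of the prior with
    support that of theta_star is kept. There the integrand is exp(- F), where the
    second differences of F along coordinate axes, with step v, are at most
    c v^2 with c = 1/B^2 + M Loo^2 n / 2; symmetrising one coordinate at a time around
    theta_star gives \int exp(- F) >= (2 pi / c)^(s/2) exp(- F theta_star) without
    any determinant. *)

Set Implicit Arguments.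
Unset Strict Implicit.
Unset Printing Implicit Defensive.

Import Order.TTheory GRing.Theory Num.Theory.
Import numFieldNormedType.Exports.

Local Open Scope classical_set_scope.
Local Open Scope ring_scope.

(** * Jensen gaps of psi *)

Section convexity.
Context {R : realType}.
Implicit Types (psi g : R -> R) (x y z b m M : R).

(** The second-derivative test for convexity, at weight 1/2. The sign of [g2] is asked for between
    [x] and [y] only, so that strong convexity on [[- b, b]] can feed it. *)
Lemma derive2_ge0_midpoint g g1 g2 x y :
  (forall z, is_derive z 1 g (g1 z)) -> (forall z, is_derive z 1 g1 (g2 z)) ->
  (forall z, x <= z <= y -> 0 <= g2 z) -> x <= y ->
  2 * g ((x + y) / 2) <= g x + g y.
Proof.
move=> dg dg1 g2_ge0 xy.
have Dg : 'D_1 g = g1 by apply/funext => z; have [] := dg z.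
have Dg1 z : 'D_1 g1 z = g2 z by have [] := dg1 z.
have cg z : {for z, continuous g}.
  by apply/differentiable_continuous/derivable1_diffP; have [] := dg z.
have h01 : 0 <= (2^-1 : R) by lra.
have h11 : (2^-1 : R) <= 1 by lra.
have := @second_derivative_convex R g x y _ _ _ _ _ (Itv01 h01 h11) xy.
rewrite !convRE /= => H.
have -> : (x + y) / 2 = 2^-1 * x + (1 - 2^-1) * y by field.
suff : g (2^-1 * x + (1 - 2^-1) * y) <= 2^-1 * g x + (1 - 2^-1) * g y by lra.
apply: H.
- by move=> z /andP[xz zy]; rewrite Dg Dg1 g2_ge0// !ltW.
- exact/cvg_at_left_filter/cg.
- exact/cvg_at_right_filter/cg.
- by move=> z _; have [] := dg z.
- by move=> z _; rewrite Dg; have [] := dg1 z.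
Qed.

Lemma smooth_is_derive psi M z : smooth M psi ->
  is_derive z 1 psi ((derive1 psi) z) /\ is_derive z 1 (derive1 psi) (derive1n 2 psi z).
Proof.
move=> /(_ z)[d1 d2 _]; split; first exact: (DeriveDef d1 (esym (derive1E _ _))).
exact: (DeriveDef d2 (esym (derive1E _ _))).
Qed.

(** Since [M / 2 * x ^+ 2 - psi x] is convex, this is its midpoint inequality between [z - v] and
    [z + v]; no first-order term survives. *)
Lemma smooth_midpoint psi M z v : smooth M psi ->
  psi (z + v) + psi (z - v) <= 2 * psi z + M * v ^+ 2.
Proof.
move=> sm.
wlog v0 : v / 0 <= v.
  move=> H; have [/H //|v0] := lerP 0 v.
  have := H (- v); rewrite opprK sqrrN addrC; apply; rewrite oppr_ge0 ltW//.
have := @derive2_ge0_midpoint (fun x => 2^-1 * M * x ^+ 2 - psi x)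
  (fun x => M * x - (derive1 psi) x) (fun x => M - derive1n 2 psi x) (z - v) (z + v).
have -> : (z - v + (z + v)) / 2 = z by field.
move=> H; suff : 2 * (2^-1 * M * z ^+ 2 - psi z) <=
    2^-1 * M * (z - v) ^+ 2 - psi (z - v) +
    (2^-1 * M * (z + v) ^+ 2 - psi (z + v)).
  by rewrite !expr2; lra.
apply: H.
- move=> x; have [d1 _] := smooth_is_derive x sm.
  by apply: is_derive_eq; rewrite /GRing.scale/=; field.
- move=> x; have [_ d2] := smooth_is_derive x sm.
  by apply: is_derive_eq; rewrite /GRing.scale/=; ring.
- by move=> x _; have [_ _] := sm x; rewrite subr_ge0.
- by rewrite lerD2l ge0_cp.
Qed.

(** Midpoint convexity of [psi x - m / 2 * x ^+ 2] on [[- b, b]]; the quadratic part contributes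
    [m / 4 * (x - y) ^+ 2]. *)
Lemma strongly_convex_midpoint psi M m b x y : smooth M psi ->
  strongly_convex_on `[- b, b] m psi -> `|x| <= b -> `|y| <= b ->
  m / 4 * (x - y) ^+ 2 + 2 * psi ((x + y) / 2) <= psi x + psi y.
Proof.
move=> sm sc.
wlog xy : x y / x <= y.
  move=> H xb yb; have [xy|/ltW yx] := lerP x y; first exact: H.
  by have := H _ _ yx yb xb; rewrite -(sqrrN (x - y)) opprB (addrC x) (addrC (psi x)).
rewrite !ler_norml => /andP[bx _] /andP[_ yb].
have := @derive2_ge0_midpoint (fun x => psi x - 2^-1 * m * x ^+ 2)
  (fun x => (derive1 psi) x - m * x) (fun x => derive1n 2 psi x - m) x y.
move=> H; suff : 2 * (psi ((x + y) / 2) - 2^-1 * m * ((x + y) / 2) ^+ 2) <=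
    psi x - 2^-1 * m * x ^+ 2 + (psi y - 2^-1 * m * y ^+ 2).
  by rewrite !expr2; lra.
apply: H => //.
- move=> z; have [d1 _] := smooth_is_derive z sm.
  by apply: is_derive_eq; rewrite /GRing.scale/=; field.
- move=> z; have [_ d2] := smooth_is_derive z sm.
  by apply: is_derive_eq; rewrite /GRing.scale/=; ring.
- move=> z /andP[xz zy]; rewrite subr_ge0; apply: sc.
  by rewrite /= in_itv/= (le_trans bx)//= (le_trans zy).
Qed.

Lemma convex_functionP psi : convex_function [set: R^o] (psi : R^o -> R^o) ->
  forall x y t, 0 <= t <= 1 ->
  psi (t * x + (1 - t) * y) <= t * psi x + (1 - t) * psi y.
Proof.
move=> cvx x y t /andP[t0 t1].
by have := cvx (Itv01 t0 t1) x y (in_setT _) (in_setT _); rewrite !convRE.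
Qed.

Lemma trunc_id b z : `|z| <= b -> trunc b z = z.
Proof.
by rewrite ler_norml /trunc => /andP[bz zb]; rewrite (min_idPl zb) (max_idPl bz).
Qed.

Lemma trunc_norm_le b z : 0 < b -> `|trunc b z| <= b.
Proof.
move=> b0; rewrite ler_norml /trunc le_max lexx orbT ge_max ge_min lexx orbT/=.
by lra.
Qed.

(* Moving z outwards from the point b past which it is truncated only increases
   the gap: b and q = (z + w) / 2 are convex combinations of p = (b + w) / 2
   and z, with weights making 2 psi(q) + psi(b) <= 2 psi(p) + psi(z). *)
Lemma convex_midpoint_gap psi b z w :
  convex_function [set: R^o] (psi : R^o -> R^o) -> w <= b -> b <= z ->
  psi b + psi w - 2 * psi ((b + w) / 2) <= psi z + psi w - 2 * psi ((z + w) / 2).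
Proof.
move=> cvx wb bz.
have [->//|zb] := eqVneq z b.
set p := (b + w) / 2; set q := (z + w) / 2.
have pz : 0 < z - p.
  by have : b < z; [rewrite lt_neqAle eq_sym zb | rewrite /p; lra].
have pz0 : z - p != 0 by rewrite gt_eqF.
(* [s] solves [b = 2 * s * p + (1 - 2 * s) * z]. The inequality [p <= b] gives [2 * s <= 1], and the
   same [s] gives [q = (1 - s) * p + s * z]. *)
pose s := (z - b) / (2 * (z - p)).
have sE : s * (2 * (z - p)) = z - b by rewrite /s divfK// mulf_neq0.
have s0 : 0 <= s by rewrite /s divr_ge0//; lra.
have s1 : 2 * s <= 1.
  rewrite -(ler_pM2r pz) mul1r (_ : 2 * s * (z - p) = z - b).
    by rewrite /p; lra.
  by rewrite -sE; ring.
have eb : b = 2 * s * p + (1 - 2 * s) * z.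
  rewrite (_ : 2 * s * p + _ = z - s * (2 * (z - p))); last by ring.
  by rewrite sE; ring.
have eq : q = (1 - s) * p + (1 - (1 - s)) * z.
  rewrite (_ : (1 - s) * p + _ = p + s * (2 * (z - p)) / 2); last by field.
  by rewrite sE /q /p; field.
have h2s : 0 <= 2 * s <= 1 by rewrite s1 mulr_ge0.
have h1s : 0 <= 1 - s <= 1 by apply/andP; split; lra.
clear sE s1 s0.
have := convex_functionP cvx p z h2s; rewrite -eb => Hb.
have := convex_functionP cvx p z h1s; rewrite -eq => Hq.
clear h2s h1s eb eq.
have : 2 * psi q + psi b <= 2 * psi p + psi z.
  apply: (le_trans (lerD (ler_wpM2l _ Hq) Hb)) => //.
  by rewrite le_eqVlt; apply/orP; left; apply/eqP; ring.
lra.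
Qed.

End convexity.

(** * Measures given by a density *)

Section density.
Local Open Scope ereal_scope.
Context d (T : measurableType d) (R : realType).
Variables (M : {measure set T -> \bar R}) (f : T -> R).
Hypotheses (f_ge0 : forall x, (0 <= f x)%R) (mf : measurable_fun setT f).

Import HBNNSimple.

Let mEf : measurable_fun setT (fun x => (f x)%:E).
Proof. exact/measurable_EFinP. Qed.

(** The measures of the statement are bare set functions. Existence lemmas of this shape exhibit a
    measure structure with the same underlying function, so that rewriting with the equality brings
    integration theory to bear on them. *)
Lemma density_measure_ex : exists N : {measure set T -> \bar R},
  N = (fun A => \int[M]_(x in A) (f x)%:E) :> (set T -> \bar R).
Proof.
pose mu := fun A => \int[M]_(x in A) (f x)%:E.
have mu0 : mu set0 = 0 by rewrite /mu integral_set0.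
have mu_ge0 A : 0 <= mu A by apply: integral_ge0 => x _; rewrite lee_fin.
have mu_sigma : semi_sigma_additive mu.
  move=> F mF tF mUF; rewrite /mu ge0_integral_bigcup//; last first.
    - by move=> x _; rewrite lee_fin.
    - exact: measurable_funTS.
  by apply: is_cvg_ereal_nneg_natsum_cond => n _ _; exact: mu_ge0.
by exists (HB.pack_for {measure set T -> \bar R} mu (isMeasure.Build _ _ _ mu mu0 mu_ge0 mu_sigma)).
Qed.

(** The two sides agree on simple functions, and monotone convergence extends this to [g]. *)
Lemma ge0_integral_density (N : {measure set T -> \bar R}) (g : T -> \bar R) :
  (forall A, measurable A -> N A = \int[M]_(x in A) (f x)%:E) ->
  (forall x, 0 <= g x) -> measurable_fun setT g ->
  \int[N]_x g x = \int[M]_x (g x * (f x)%:E).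
Proof.
move=> NE g0 mg; pose h := nnsfun_approx measurableT mg.
have hg x : (h n x)%:E @[n --> \oo] --> g x.
  by apply: cvg_nnsfun_approx.
have hN n : \int[N]_x (h n x)%:E = \int[M]_x ((h n x)%:E * (f x)%:E).
  have hE x : (h n x)%:E = \sum_(y \in range (h n)) (y * \1_(h n @^-1` [set y]) x)%:E.
    by rewrite fsumEFin// -fimfunE.
  under eq_integral do rewrite hE.
  under [RHS]eq_integral.
    move=> x _; rewrite hE ge0_mule_fsuml; last first.
      by move=> y; exact: nnfun_muleindic_ge0.
    over.
  rewrite ge0_integral_fsum//; last 2 first.
    by move=> y; exact/measurable_EFinP/measurable_funM.
    by move=> y x _; exact: nnfun_muleindic_ge0.
  rewrite ge0_integral_fsum//; last 2 first.
    move=> y; apply: emeasurable_funM => //.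
    exact/measurable_EFinP/measurable_funM.
    by move=> y x _; rewrite mule_ge0 ?lee_fin//; exact: nnfun_muleindic_ge0.
  apply: eq_fsbigr => y; rewrite inE => -[x _ <-].
  under eq_integral do rewrite EFinM.
  under [RHS]eq_integral do rewrite EFinM -muleA.
  rewrite ge0_integralZl_EFin//; last first.
  - exact/measurable_EFinP.
  rewrite [RHS]ge0_integralZl_EFin//; last 2 first.
  - by move=> z _; rewrite mule_ge0 ?lee_fin.
  - by apply: emeasurable_funM => //; exact/measurable_EFinP.
  congr (_ * _).
  rewrite integral_indic// setIT NE// integral_mkcond.
  apply: eq_integral => z _; rewrite muleC epatch_indic//.
rewrite (_ : \int[N]_x g x = lim (\int[N]_x (h n x)%:E @[n --> \oo])); last first.
  rewrite -monotone_convergence//.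
  - by apply: eq_integral => x _; apply/esym/cvg_lim => //; exact: hg.
  - by move=> n; exact/measurable_EFinP.
  - by move=> n x _; rewrite lee_fin.
  - by move=> x _ a b ab; rewrite lee_fin; exact/lefP/nd_nnsfun_approx.
under eq_fun do rewrite hN.
rewrite -monotone_convergence//.
- apply: eq_integral => x _; apply/cvg_lim => //.
  by apply: cvgeZr => //; exact: hg.
- by move=> n; apply: emeasurable_funM => //; exact/measurable_EFinP.
- by move=> n x _; rewrite mule_ge0 ?lee_fin.
- move=> x _ a b ab; rewrite lee_wpmul2r ?lee_fin//.
  exact/lefP/nd_nnsfun_approx.
Qed.

End density.

(** * Lebesgue measure on tuples *)

Section pushforward.
Local Open Scope ereal_scope.
Context d1 d2 (T1 : measurableType d1) (T2 : measurableType d2) (R : realType).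

Lemma pushforward_measure_ex (m : {measure set T1 -> \bar R}) (f : T1 -> T2) :
  measurable_fun setT f -> exists N : {measure set T2 -> \bar R},
    N = pushforward m f :> (set T2 -> \bar R) /\
    forall g, (forall x, 0 <= g x) -> measurable_fun setT g ->
      \int[N]_x g x = \int[m]_x g (f x).
Proof.
move=> mf; unshelve eexists (pushforward m f); first exact: mf.
by split => // g g0 mg; rewrite (@ge0_integral_pushforward _ _ _ _ _ _ mf).
Qed.

End pushforward.

(** Rectangles of two exhausting sequences with the same index suffice, because both sequences are
    taken nondecreasing. *)
Lemma product_sigma_finite d1 d2 (T1 : measurableType d1) (T2 : measurableType d2)
  (R : realType) (m1 : {sigma_finite_measure set T1 -> \bar R})
  (m2 : {sigma_finite_measure set T2 -> \bar R}) :
  sigma_finite setT (m1 \x m2)%E.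
Proof.
have /sigma_finiteP[F [TF ndF Foo]] := sigma_finiteT m1.
have /sigma_finiteP[G [TG ndG Goo]] := sigma_finiteT m2.
exists (fun n => F n `*` G n).
  apply/seteqP; split => // -[x y] _.
  have [i _ Fx] : (\bigcup_i F i) x by rewrite -TF.
  have [j _ Gy] : (\bigcup_i G i) y by rewrite -TG.
  exists (maxn i j) => //; split.
    by move: Fx; exact/subsetPset/ndF/leq_maxl.
  by move: Gy; exact/subsetPset/ndG/leq_maxr.
move=> k; have [mF Fk] := Foo k; have [mG Gk] := Goo k.
split; first exact: measurableX.
by rewrite product_measure1E// lte_mul_pinfty// ge0_fin_numE.
Qed.

Section sigma_finite_measure_ex.
Context d (T : measurableType d) (R : realType) (mu : {measure set T -> \bar R}).
Hypothesis mu_sigma_finite : sigma_finite setT mu.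

(** An alias of [mu], giving a fresh head constant to which an instance resting on the hypothesis
    [mu_sigma_finite] can be attached. *)
Definition measure_copy : set T -> \bar R := mu.

HB.instance Definition _ := Measure.on measure_copy.
HB.instance Definition _ :=
  Measure_isSigmaFinite.Build _ _ _ measure_copy mu_sigma_finite.

Lemma sigma_finite_measure_ex : exists M : {sigma_finite_measure set T -> \bar R},
  M = mu :> (set T -> \bar R).
Proof. by exists measure_copy. Qed.

End sigma_finite_measure_ex.

Section lebesgue_tuple.
Local Open Scope ereal_scope.
Context {R : realType}.

Lemma measurable_tuple_cons n :
  measurable_fun setT (fun p : R * n.-tuple R => [tuple of p.1 :: p.2]).
Proof. exact: measurable_cons. Qed.

(** Sigma-finiteness is carried through the induction because Tonelli's theorem on the next product
    depends on it. *)
Lemma lebesgue_tuple_measure_ex n :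
  exists M : {sigma_finite_measure set (n.-tuple R) -> \bar R},
    M = @lebesgue_tuple R n :> (set (n.-tuple R) -> \bar R).
Proof.
elim: n => [|n [M IH]]; first by exists \d_([tuple] : 0.-tuple R).
have [N [NE NI]] := pushforward_measure_ex (@lebesgue_measure R \x M)
  (@measurable_tuple_cons n).
have sN : sigma_finite setT N.
  have [F FT Foo] : sigma_finite setT (@lebesgue_measure R \x M).
    exact: product_sigma_finite.
  (* [g] inverts the cons map; preimages under [g] turn an exhausting sequence of the product into
     one for its pushforward. *)
  pose g := fun t : n.+1.-tuple R => (thead t, [tuple of behead t]).
  have mg : measurable_fun setT g.
    by apply/measurable_fun_pair; [exact: measurable_tnth|exact: measurable_behead].
  exists (fun k => g @^-1` F k).
    by rewrite -preimage_bigcup -FT preimage_setT.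
  move=> k; have [mF Fk] := Foo k; split.
    by rewrite -[X in measurable X]setTI; exact: mg.
  rewrite NE /pushforward; congr (_ < +oo): Fk; congr (_ _).
  apply/seteqP; split => -[a u] /=; rewrite /g theadE;
    by rewrite (_ : [tuple of behead [tuple of a :: u]] = u :> n.-tuple R)//; exact: val_inj.
have [K KE] := sigma_finite_measure_ex sN.
by exists K; rewrite KE NE /= IH.
Qed.

Lemma ge0_integral_lebesgue_tupleS n (g : n.+1.-tuple R -> \bar R) :
  (forall u, 0 <= g u) -> measurable_fun setT g ->
  \int[@lebesgue_tuple R n.+1]_u g u =
  \int[@lebesgue_tuple R n]_u \int[@lebesgue_measure R]_a g [tuple of a :: u].
Proof.
move=> g0 mg; have [M ME] := lebesgue_tuple_measure_ex n.
have [N [NE NI]] := pushforward_measure_ex (@lebesgue_measure R \x M)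
  (@measurable_tuple_cons n).
rewrite /= -ME -NE NI// fubini_tonelli2//.
exact: (measurableT_comp mg (@measurable_tuple_cons n)).
Qed.

Lemma ge0_integral_lebesgue_tuple0 (g : 0.-tuple R -> \bar R) :
  (forall u, 0 <= g u) -> \int[@lebesgue_tuple R 0]_u g u = g [tuple].
Proof.
move=> g0; rewrite integral_dirac ?diracT ?mul1e// => _ Y mY; rewrite setTI.
(* The space [0.-tuple R] has one point, so every preimage is full or empty and [g] is
   measurable. *)
have [y|n] := pselect (Y (g [tuple])).
  by rewrite (_ : _ @^-1` _ = setT)//; apply/seteqP; split => // u _ /=; rewrite tuple0.
by rewrite (_ : _ @^-1` _ = set0)//; apply/seteqP; split => // u /=; rewrite tuple0.
Qed.

End lebesgue_tuple.

(** * Gaussian integrals *)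

Section lebesgue_invariance.
Local Open Scope ereal_scope.
Context {R : realType}.
Notation mu := (@lebesgue_measure R).

Lemma ge0_integral_lebesgueN (f : R -> \bar R) :
  (forall x, 0 <= f x) -> measurable_fun setT f ->
  \int[mu]_x f (- x)%R = \int[mu]_x f x.
Proof.
move=> f0 mf.
have mN : measurable_fun setT (-%R : R -> measurableTypeR R) by [].
have [N [NE NI]] := pushforward_measure_ex mu mN.
rewrite -NI//; apply: eq_measure_integral => A mA _.
by rewrite NE lebesgue_measureN.
Qed.

(** The image of Lebesgue measure under a translation has the same values on half-open intervals,
    and these determine the measure. *)
Lemma ge0_integral_lebesgueD (f : R -> \bar R) a :
  (forall x, 0 <= f x) -> measurable_fun setT f ->
  \int[mu]_x f (a + x)%R = \int[mu]_x f x.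
Proof.
move=> f0 mf.
have mD : measurable_fun setT (+%R a : R -> measurableTypeR R) by exact: measurable_funD.
have [N [NE NI]] := pushforward_measure_ex mu mD.
rewrite -NI//; apply: eq_measure_integral => A mA _.
apply/esym/lebesgue_measure_unique => // _ [[x y]] _ <-.
rewrite NE /pushforward (_ : _ @^-1` _ = `](x - a)%R, (y - a)%R]%classic).
  rewrite /= !lebesgue_measure_itv/= !lte_fin ltrD2r -!EFinD.
  by case: ifP => // _; congr (_%:E); ring.
by apply/seteqP; split => z/=; rewrite !in_itv/= ltrBlDl lerBrDl.
Qed.

(** Read off from the total mass 1 of the normal density with mean 0 and variance [c^-1]. *)
Lemma integral_gaussian (c : R) : (0 < c)%R ->
  \int[mu]_x (expR (- (c * x ^+ 2 / 2)))%:E = (Num.sqrt (2 * pi / c))%:E.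
Proof.
move=> c0; pose s : R := (Num.sqrt c)^-1%R.
have s0 : (0 < s)%R by rewrite invr_gt0 sqrtr_gt0.
have sE : (s ^+ 2 = c^-1)%R by rewrite /s exprVn sqr_sqrtr// ltW.
have := integral_normal_pdf 0 s.
under eq_integral => x _.
  rewrite normal_pdfE ?gt_eqF// EFinM /normal_fun subr0 sE.
  rewrite (_ : - x ^+ 2 / (c^-1 *+ 2) = - (c * x ^+ 2 / 2))%R; last first.
    by field; rewrite gt_eqF.
  over.
rewrite ge0_integralZl_EFin//; last 2 first.
- apply/measurable_EFinP/measurableT_comp => //; apply: measurableT_comp => //.
  by apply: measurable_funM => //; apply: measurable_funM => //; exact: measurable_funX.
- exact: normal_peak_ge0.
move=> H.
have pk : ((normal_peak s)^-1 = Num.sqrt (2 * pi / c))%R.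
  rewrite /normal_peak invrK sE; congr (Num.sqrt _)%R; rewrite -mulr_natl; ring.
rewrite -pk -[LHS]mul1e -[X in X%:E * _](@mulVf _ (normal_peak s)); last first.
  by rewrite gt_eqF// normal_peak_gt0// gt_eqF.
by rewrite EFinM -muleA H mule1.
Qed.

Lemma measurable_expRN d (T : measurableType d) (g : T -> R) :
  measurable_fun setT g -> measurable_fun setT (fun x => (expR (- g x))%:E).
Proof.
by move=> mg; apply/measurable_EFinP; do 2 apply: measurableT_comp => //.
Qed.

(* Symmetrising around the point a, the first-order term of g disappears. *)
Lemma integral_expRN_ge (g : R -> R) (c a : R) : (0 < c)%R ->
  measurable_fun setT g ->
  (forall v, g (a + v) + g (a - v) <= 2 * g a + c * v ^+ 2)%R ->
  (Num.sqrt (2 * pi / c) * expR (- g a))%:E <= \int[mu]_x (expR (- g x))%:E.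
Proof.
move=> c0 mg H.
have e0 (z : R) : 0 <= (expR z)%:E by rewrite lee_fin expR_ge0.
have mgD : measurable_fun setT (fun v : R => g (a + v)%R).
  by apply: measurableT_comp => //; exact: measurable_funD.
have mgN : measurable_fun setT (fun v : R => g (a - v)%R).
  by apply: measurableT_comp => //; exact: measurable_funB.
have mq : measurable_fun setT (fun v : R => c * v ^+ 2 / 2)%R.
  by apply: measurable_funM => //; apply: measurable_funM => //; exact: measurable_funX.
have mE := measurable_expRN mg.
have I1 : \int[mu]_x (expR (- g (a + x)))%:E = \int[mu]_x (expR (- g x))%:E.
  exact: (ge0_integral_lebesgueD a _ mE).
have I2 : \int[mu]_x (expR (- g (a - x)))%:E = \int[mu]_x (expR (- g x))%:E.
  by rewrite -I1 (ge0_integral_lebesgueN _ (measurable_expRN mgD)).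
rewrite EFinM -integral_gaussian// -ge0_integralZr//; last exact: measurable_expRN.
have h0 : (0 <= 2^-1 :> R)%R by rewrite invr_ge0.
(* Translation and reflection invariance make the integral the average of its two versions centred
   at [a]; an infinite integral is a separate case. *)
rewrite [leRHS](_ : _ = 2^-1%:E * (\int[mu]_x (expR (- g (a + x)))%:E +
    \int[mu]_x (expR (- g (a - x)))%:E)); last first.
  rewrite I1 I2; set I := (\int[mu]_x _).
  have : 0 <= I by exact: integral_ge0.
  clearbody I; case: I => [r _|_|]; last by rewrite leeNy_eq.
    by rewrite -EFinD -EFinM; congr (_%:E); field.
  by rewrite addye// gt0_muley// lte_fin invr_gt0.
rewrite -ge0_integralD//; [|exact: measurable_expRN..].
rewrite -ge0_integralZl_EFin//; last 2 first.
- by move=> x _; rewrite adde_ge0.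
- by apply: emeasurable_funD; exact: measurable_expRN.
apply: ge0_le_integral => //.
- apply: emeasurable_funM => //; exact: measurable_expRN.
- apply: emeasurable_funM => //; apply: emeasurable_funD; exact: measurable_expRN.
move=> v _; rewrite -EFinD -!EFinM lee_fin -expRD.
set p := g (a + v)%R; set q := g (a - v)%R.
apply: (@le_trans _ _ (expR (- ((p + q) / 2)%R))).
  by rewrite ler_expR; have := H v; rewrite -/p -/q; lra.
(* The arithmetic-geometric mean inequality for [expR (- p)] and [expR (- q)]: the first-order terms
   of the two bounds [1 + x <= expR x] cancel. *)
have := expR_ge1Dx ((q - p) / 2)%R; have := expR_ge1Dx ((p - q) / 2)%R.
have e1 : (expR (- p) = expR (- ((p + q) / 2)) * expR ((q - p) / 2))%R.
  by rewrite -expRD; congr expR; field.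
have e2 : (expR (- q) = expR (- ((p + q) / 2)) * expR ((p - q) / 2))%R.
  by rewrite -expRD; congr expR; field.
rewrite e1 e2 => h1 h2.
have := expR_gt0 (- ((p + q) / 2))%R; set e := expR _ => e_gt0.
rewrite -mulrDr mulrCA -[leLHS]mulr1 ler_pM2l//; lra.
Qed.

End lebesgue_invariance.

Section gaussian_tuple.
Context {R : realType}.
Notation mu := (@lebesgue_measure R).

Definition shift_coord n (u : n.-tuple R) (i : 'I_n) (v : R) : n.-tuple R :=
  [tuple tnth u j + (if j == i then v else 0) | j < n].

Lemma dotp_cons n (a b : R) (u v : n.-tuple R) :
  dotp [tuple of a :: u] [tuple of b :: v] = a * b + dotp u v.
Proof.
rewrite /dotp big_ord_recl; congr (_ * _ + _).
by apply: eq_bigr => i _; rewrite !tnthS.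
Qed.

Lemma shift_coord_cons0 n (a v : R) (u : n.-tuple R) :
  shift_coord [tuple of a :: u] ord0 v = [tuple of (a + v) :: u].
Proof.
apply: eq_from_tnth => j; rewrite tnth_mktuple.
by case: (unliftP ord0 j) => [k ->|->]; rewrite ?tnthS ?addr0// !tnth0.
Qed.

Lemma shift_coord_consS n (a v : R) (u : n.-tuple R) i :
  shift_coord [tuple of a :: u] (lift ord0 i) v = [tuple of a :: shift_coord u i v].
Proof.
apply: eq_from_tnth => j; rewrite tnth_mktuple.
case: (unliftP ord0 j) => [k ->|->]; rewrite ?tnthS ?tnth0 ?addr0//.
by rewrite tnth_mktuple (inj_eq lift_inj).
Qed.

Lemma measurable_dotp d (T : measurableType d) n (f g : T -> n.-tuple R) :
  measurable_fun setT f -> measurable_fun setT g ->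
  measurable_fun setT (fun x => dotp (f x) (g x)).
Proof.
move=> mf mg; apply: measurable_sum => i; apply: measurable_funM.
  exact: (measurableT_comp (measurable_tnth i) mf).
exact: (measurableT_comp (measurable_tnth i) mg).
Qed.

Lemma integral_gaussian_tuple n (c : R) : 0 < c ->
  (\int[@lebesgue_tuple R n]_u (expR (- (c * dotp u u / 2)))%:E =
   (Num.sqrt (2 * pi / c) ^+ n)%:E)%E.
Proof.
move=> c0; elim: n => [|n IH].
  rewrite ge0_integral_lebesgue_tuple0; last by move=> u; rewrite lee_fin expR_ge0.
  by rewrite /dotp big_ord0 mulr0 mul0r oppr0 expR0 expr0.
have mdot k : measurable_fun setT (fun u : k.-tuple R => c * dotp u u / 2).
  apply: measurable_funM => //; apply: measurable_funM => //.
  exact: measurable_dotp.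
rewrite ge0_integral_lebesgue_tupleS; last 2 first.
- by move=> u; rewrite lee_fin expR_ge0.
- exact: (measurable_expRN (mdot _)).
have [M ME] := @lebesgue_tuple_measure_ex R n; rewrite -ME.
transitivity (\int[M]_u ((Num.sqrt (2 * pi / c))%:E *
    (expR (- (c * dotp u u / 2)))%:E))%E.
  apply: eq_integral => u _; rewrite -integral_gaussian// -ge0_integralZr//.
  - apply: eq_integral => a _; rewrite dotp_cons -EFinM -expRD; congr (expR _)%:E.
    by field.
  - apply: measurable_expRN; apply: measurable_funM => //.
    by apply: measurable_funM => //; exact: measurable_funX.
rewrite ge0_integralZl_EFin//; last exact: (measurable_expRN (mdot _)).
by rewrite /= ME IH -EFinM exprS.
Qed.

(** For every fixed tail the first coordinate is integrated by [integral_expRN_ge] around the head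
    [a] of [u0]; the induction hypothesis then treats [F [tuple of a :: t]] as a function of the
    tail. The second-difference bound is therefore assumed at every [u], not only at [u0]. *)
Lemma integral_expRN_tuple_ge n (F : n.-tuple R -> R) (c : R) u0 : 0 < c ->
  measurable_fun setT F ->
  (forall i u v, F (shift_coord u i v) + F (shift_coord u i (- v)) <=
                 2 * F u + c * v ^+ 2) ->
  ((Num.sqrt (2 * pi / c) ^+ n * expR (- F u0))%:E <=
   \int[@lebesgue_tuple R n]_u (expR (- F u))%:E)%E.
Proof.
move=> c0; elim: n F u0 => [|n IH] F u0 mF HF.
  rewrite ge0_integral_lebesgue_tuple0; last by move=> u; rewrite lee_fin expR_ge0.
  by rewrite expr0 mul1r tuple0.
have mE := measurable_expRN mF.
rewrite ge0_integral_lebesgue_tupleS//.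
have [M ME] := @lebesgue_tuple_measure_ex R n; rewrite -ME.
case/tupleP: u0 => a u.
have mcons := @measurable_tuple_cons R n.
have mFa b : measurable_fun setT (fun t : n.-tuple R => F [tuple of b :: t]).
  apply: (measurableT_comp mF); apply: measurable_cons => //.
apply: (@le_trans _ _ ((Num.sqrt (2 * pi / c))%:E *
    \int[M]_t (expR (- F [tuple of a :: t]))%:E)%E).
  rewrite exprS -mulrA EFinM lee_wpmul2l ?lee_fin ?sqrtr_ge0// ME.
  apply: (IH (fun t => F [tuple of a :: t])) => // i t v.
  by rewrite -!shift_coord_consS.
rewrite -ge0_integralZl_EFin//; last exact: (measurable_expRN (mFa a)).
apply: ge0_le_integral => //.
- by apply: emeasurable_funM => //; exact: (measurable_expRN (mFa a)).
- apply: (measurable_fun_fubini_tonelli_G (m1 := mu)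
    (fun p : R * n.-tuple R => (expR (- F [tuple of p.1 :: p.2]))%:E)).
    exact: (measurableT_comp mE mcons).
  by move=> p; rewrite lee_fin expR_ge0.
move=> t _; apply: (integral_expRN_ge (g := fun b => F [tuple of b :: t])) => //.
- apply: (measurableT_comp mF); exact: measurable_cons.
- by move=> v; rewrite -!shift_coord_cons0.
Qed.

End gaussian_tuple.

(** * The prior *)

Section normalized.
Local Open Scope ereal_scope.
Context d (T : measurableType d) (R : realType).

Lemma normalized_density_ex (M : {measure set T -> \bar R}) (f : T -> R) (k : R) :
  (forall x, (0 <= f x)%R) -> measurable_fun setT f -> (0 < k)%R ->
  \int[M]_x (f x)%:E = k%:E ->
  exists N : {measure set T -> \bar R},
    N = normalized_density M f :> (set T -> \bar R) /\
    forall g, (forall x, 0 <= g x) -> measurable_fun setT g ->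
      \int[N]_x g x = (k^-1)%:E * \int[M]_x (g x * (f x)%:E).
Proof.
move=> f0 mf k0 fk; have [N NE] := density_measure_ex M f0 mf.
have ik0 : (0 <= k^-1)%R by rewrite invr_ge0 ltW.
exists (mscale (NngNum ik0) N); split.
  apply/funext => A; transitivity ((k^-1)%:E * N A) => //.
  by rewrite NE /normalized_density fk inver gt_eqF// muleC.
move=> g g0 mg; rewrite ge0_integral_mscale//=; congr (_ * _).
by apply: ge0_integral_density => // A _; rewrite NE.
Qed.

(** Intended for the mixture over subsets. The functional [nu i] lets the integral against each
    component be supplied in a form already computed. *)
Lemma weighted_sum_measure_ex (I : Type) (r : seq I) (w : I -> R)
    (mu : I -> set T -> \bar R) (nu : I -> (T -> \bar R) -> \bar R) :
  (forall i, (0 <= w i)%R) ->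
  (forall i, exists N : {measure set T -> \bar R}, N = mu i :> (set T -> \bar R) /\
     forall g, (forall x, 0 <= g x) -> measurable_fun setT g ->
     \int[N]_x g x = nu i g) ->
  exists N : {measure set T -> \bar R},
    N = (fun A => \sum_(i <- r) (w i)%:E * mu i A) :> (set T -> \bar R) /\
    forall g, (forall x, 0 <= g x) -> measurable_fun setT g ->
     \int[N]_x g x = \sum_(i <- r) (w i)%:E * nu i g.
Proof.
move=> w0 H; elim: r => [|i r [N [NE NI]]].
  exists mzero; split; first by apply/funext => A; rewrite big_nil.
  by move=> g _ _; rewrite big_nil integral_measure_zero.
have [K [KE KI]] := H i.
exists (measure_add (mscale (NngNum (w0 i)) K) N); split.
  apply/funext => A; rewrite big_cons -KE.
  transitivity ((w i)%:E * K A + N A); last by rewrite NE.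
  exact: measure_addE.
move=> g g0 mg; rewrite ge0_integral_measure_add// ge0_integral_mscale//=.
by rewrite big_cons KI// NI.
Qed.

End normalized.

Section prior_measure.
Context {R : realType} (d : nat).
Implicit Types (S : {set 'I_d}) (B : R).

Lemma embed_coordsE S (v : #|S|.-tuple R) (i : 'I_#|S|) :
  tnth (embed_coords v) (enum_val i) = tnth v i.
Proof.
rewrite tnth_mktuple enum_valP /enum_val index_uniq ?enum_uniq//.
- by rewrite (tnth_nth 0).
- by rewrite -cardE.
Qed.

Lemma embed_coords_out S (v : #|S|.-tuple R) j : j \notin S ->
  tnth (embed_coords v) j = 0.
Proof. by rewrite tnth_mktuple => /negbTE ->. Qed.

Lemma measurable_embed_coords S :
  measurable_fun setT (@embed_coords R d S).
Proof.
apply/measurable_fun_tnthP => j; have [jS|jS] := boolP (j \in S).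
  rewrite (_ : _ \o _ = (@tnth _ R ^~ (enum_rank_in jS j))); last first.
    by apply/funext => v /=; rewrite -[in LHS](enum_rankK_in jS jS) embed_coordsE.
  exact: measurable_tnth.
rewrite (_ : _ \o _ = cst 0)//; apply/funext => v /=.
exact: embed_coords_out.
Qed.

Lemma dotp_embed_coords S (v : #|S|.-tuple R) :
  dotp (embed_coords v) (embed_coords v) = dotp v v.
Proof.
rewrite /dotp (bigID (mem S))/= [X in _ + X]big1 ?addr0; last first.
  by move=> j jS; rewrite embed_coords_out// mul0r.
rewrite big_enum_val/=; apply: eq_bigr => i _; by rewrite embed_coordsE.
Qed.

(** Second differences on [Theta_S] along its own axes thus reduce to second differences along axes
    of the full space. *)
Lemma embed_shift_coord S (v : #|S|.-tuple R) i a :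
  embed_coords (shift_coord v i a) = shift_coord (embed_coords v) (enum_val i) a.
Proof.
apply: eq_from_tnth => j; rewrite [in RHS]tnth_mktuple.
have [jS|jS] := boolP (j \in S).
  rewrite -(enum_rankK_in jS jS) !embed_coordsE tnth_mktuple.
  by rewrite (inj_eq enum_val_inj).
rewrite !embed_coords_out//; case: eqP => [ji|_]; last by rewrite addr0.
by move: jS; rewrite ji enum_valP.
Qed.

Lemma embed_restrict S (u : d.-tuple R) : supp u \subset S ->
  embed_coords [tuple tnth u (enum_val i) | i < #|S|] = u.
Proof.
move=> /fintype.subsetP uS; apply: eq_from_tnth => j.
have [jS|jS] := boolP (j \in S).
  by rewrite -(enum_rankK_in jS jS) embed_coordsE tnth_mktuple.
rewrite embed_coords_out//; apply/esym/eqP; apply: contraNT jS => uj.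
by apply: uS; rewrite inE.
Qed.

Lemma dotp_ge0 n (u : n.-tuple R) : 0 <= dotp u u.
Proof. by apply: sumr_ge0 => i _; rewrite -expr2 sqr_ge0. Qed.

Lemma norm2_sqr n (u : n.-tuple R) : norm2 u ^+ 2 = dotp u u.
Proof. by rewrite sqr_sqrtr// dotp_ge0. Qed.

Lemma subset_weight_gt0 S : 0 < @subset_weight R d S.
Proof.
rewrite /subset_weight divr_gt0// ?exprn_gt0 ?invr_gt0 ?exprn_gt0//.
rewrite mulr_gt0// ?ltr0n ?bin_gt0; first by rewrite -[leqRHS]card_ord max_card.
rewrite big_nat_recl// ltr_wpDr// ?expr0 ?invr1//.
by apply: sumr_ge0 => i _; rewrite invr_ge0 exprn_ge0.
Qed.

(** Subsets are grouped by cardinality [k]; there are ['C(d, k)] of them, which cancels the binomial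
    coefficient in the weight. *)
Lemma sum_subset_weight : \sum_(S : {set 'I_d}) @subset_weight R d S = 1.
Proof.
pose K : R := \sum_(0 <= k < d.+1) 2 ^- k.
have K0 : 0 < K.
  rewrite /K big_nat_recl// ltr_wpDr// ?expr0 ?invr1//.
  by apply: sumr_ge0 => i _; rewrite invr_ge0 exprn_ge0.
rewrite (partition_big (fun S : {set 'I_d} => inord #|S| : 'I_d.+1) predT)//=.
transitivity (\sum_(k < d.+1) (2 ^- k : R) / K).
  apply: eq_bigr => k _.
  have cS S : (inord #|S| == k :> 'I_d.+1) = (#|S| == k).
    rewrite -val_eqE /= inordK// ltnS -[leqRHS]card_ord; exact: max_card.
  rewrite (eq_bigl (fun S : {set 'I_d} => S \in [set A : {set 'I_d} | #|A| == k]%SET));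
    last by move=> S; rewrite inE cS.
  rewrite (eq_bigr (fun=> 2 ^- k / ('C(d, k)%:R * K))); last first.
    by move=> S; rewrite inE => /eqP <-.
  have C0 : ('C(d, k)%:R : R) != 0.
    by rewrite pnatr_eq0 -lt0n bin_gt0 -ltnS; exact: ltn_ord.
  rewrite sumr_const card_draws card_ord -[LHS]mulr_natl.
  rewrite mulrCA invfM (mulrA _%:R) divff ?mul1r//.
by rewrite -mulr_suml -(big_mkord predT (fun k => 2 ^- k)) divff// gt_eqF.
Qed.

Local Notation rho B := (fun u : d.-tuple R => norm2 u ^+ 2 / (2 * B ^+ 2)).

Lemma measurable_rho B : measurable_fun setT (rho B).
Proof.
apply: measurable_funM => //.
under eq_fun do rewrite norm2_sqr.
exact: measurable_dotp.
Qed.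

(** Each component is a Gaussian of variance [B ^+ 2] per coordinate, hence the normalising constant
    [Num.sqrt (2 * pi * B ^+ 2) ^+ #|S|]. The total mass is 1 because every component has mass 1
    ([nu1]) and the weights sum to 1. *)
Lemma subset_prior_ex B : 0 < B ->
  exists Q : {sigma_finite_measure set (d.-tuple R) -> \bar R},
  [/\ Q = subset_prior (rho B) :> (set _ -> \bar R),
    Q setT = 1%E &
    forall g, (forall u, 0 <= g u)%E -> measurable_fun setT g ->
    (\int[Q]_u g u = \sum_(S : {set 'I_d}) (subset_weight S)%:E *
     (((Num.sqrt (2 * pi * B ^+ 2) ^+ #|S|)^-1)%:E *
      \int[@lebesgue_tuple R #|S|]_v
        (g (embed_coords v) * (expR (- rho B (embed_coords v)))%:E)))%E].
Proof.
move=> B0.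
have mE : measurable_fun setT (fun u => expR (- rho B u)).
  by do 2 apply: measurableT_comp => //; exact: measurable_rho.
pose nu S (g : d.-tuple R -> \bar R) :=
  (((Num.sqrt (2 * pi * B ^+ 2) ^+ #|S|)^-1)%:E *
      \int[@lebesgue_tuple R #|S|]_v
        (g (embed_coords v) * (expR (- rho B (embed_coords v)))%:E))%E.
have nu1 S : nu S (cst 1%E) = 1%E.
  rewrite /nu; have [M ME] := @lebesgue_tuple_measure_ex R #|S|; rewrite -ME.
  under eq_integral => v _.
    rewrite mul1e norm2_sqr dotp_embed_coords.
    rewrite (_ : dotp v v / (2 * B ^+ 2) = (B ^+ 2)^-1 * dotp v v / 2); last first.
      by field; rewrite gt_eqF.
    over.
  rewrite /= ME integral_gaussian_tuple ?invr_gt0 ?exprn_gt0// invrK -EFinM mulVf//.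
  by rewrite gt_eqF// exprn_gt0// sqrtr_gt0 !mulr_gt0// ?pi_gt0 ?exprn_gt0.
have k0 S : 0 < Num.sqrt (2 * pi * B ^+ 2) ^+ #|S|.
  by rewrite exprn_gt0// sqrtr_gt0 !mulr_gt0// ?pi_gt0 ?exprn_gt0.
have [||Q [QE QI]] := @weighted_sum_measure_ex _ (d.-tuple R) R _
  (index_enum {set 'I_d}) (@subset_weight R d)
  (fun S => normalized_density (lebesgue_coords S) (fun u => expR (- rho B u))) nu.
- by move=> S; exact/ltW/subset_weight_gt0.
- move=> S; have [M ME] := @lebesgue_tuple_measure_ex R #|S|.
  have [L [LE LI]] := pushforward_measure_ex M (@measurable_embed_coords S).
  have Lc : L = lebesgue_coords S :> (set _ -> \bar R) by rewrite LE /lebesgue_coords -ME.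
  rewrite -Lc.
  have [||N [NE NI]] := normalized_density_ex (M := L) _ mE (k0 S).
  + by move=> u; exact: expR_ge0.
  + rewrite LI//; last by exact/measurable_EFinP.
    have H := nu1 S; rewrite /nu -ME in H.
    have {}H := congr1 (fun z => (Num.sqrt (2 * pi * B ^+ 2) ^+ #|S|)%:E * z)%E H.
    rewrite muleA -EFinM divff ?mul1e ?mule1 ?gt_eqF// in H.
    by rewrite -H; apply: eq_integral => v _; rewrite mul1e.
  exists N; split => // g g0 mg; rewrite NI// /nu -ME LI//.
  + by move=> u; rewrite mule_ge0 ?lee_fin ?expR_ge0.
  + by apply: emeasurable_funM => //; exact/measurable_EFinP.
have Q1 : Q setT = 1%E.
  rewrite -[LHS]mul1e -integral_cst// QI//.
  under eq_bigr do rewrite nu1 mule1.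
  by rewrite sumEFin sum_subset_weight.
have sQ : sigma_finite setT Q.
  by exists (fun=> setT) => [|_]; [rewrite bigcup_const//; exists 0%N|rewrite Q1 ltry].
have [K KE] := sigma_finite_measure_ex sQ.
by exists K; rewrite /= KE; split => // g g0 mg; rewrite QI.
Qed.

End prior_measure.

(** * Conditional densities *)

Section restriction.
Local Open Scope ereal_scope.
Context d (T : measurableType d) (R : realType).

Lemma integral_indicM (mu : {measure set T -> \bar R}) (D : set T) (f : T -> \bar R) :
  \int[mu]_(x in D) f x = \int[mu]_x (f x * (\1_D x)%:E).
Proof. by rewrite integral_mkcond epatch_indic. Qed.

(** The reference measure is sigma-finite on the label set; cutting it off outside gives a measure
    sigma-finite on the whole space, to which Tonelli's theorem applies. *)
Lemma restricted_measure_ex (nu : {measure set T -> \bar R}) (D : set T) :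
  measurable D -> sigma_finite D nu ->
  exists nuD : {sigma_finite_measure set T -> \bar R},
    forall g, (forall x, 0 <= g x) -> measurable_fun setT g ->
    \int[nuD]_x g x = \int[nu]_(x in D) g x.
Proof.
move=> mD [F DF Foo].
have mI : measurable_fun setT (\1_D : T -> R) by exact: measurable_indic.
have I0 x : (0 <= \1_D x :> R)%R by [].
have [N NE] := density_measure_ex nu I0 mI.
have NA A : measurable A -> N A = nu (A `&` D).
  by move=> mA; rewrite NE integral_indic// setIC.
have sN : sigma_finite setT N.
  (* The complement of [D] is null for [N], so adding it to every [F k] costs nothing and covers the
     whole space. *)
  exists (fun k => F k `|` ~` D).
    apply/seteqP; split => // x _; have [|nDx] := pselect (D x).
      by rewrite DF => -[k _ Fx]; exists k => //; left.
    by exists 0%N => //; right.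
  move=> k; have [mF Fk] := Foo k.
  have mFD : measurable (F k `|` ~` D) by apply: measurableU => //; exact: measurableC.
  split => //; rewrite NA// setIUl setICl setU0.
  by apply: le_lt_trans Fk; apply: le_measure; rewrite ?inE//; exact: measurableI.
have [K KE] := sigma_finite_measure_ex sN.
exists K => g g0 mg; rewrite integral_indicM; apply: ge0_integral_density => //.
by move=> A mA; rewrite /= KE NE.
Qed.

End restriction.

Section conditional_density.
Local Open Scope ereal_scope.
Context {R : realType} {dO : measure_display} {Omega : measurableType dO}.
Variables (P : probability Omega R) (G : set (set Omega)).
Hypothesis mG : G `<=` measurable.

(** [T] is [Omega] with the smaller sigma-algebra generated by [G]: a function depends measurably on
    the past when it is measurable on [T]. *)
Let T := g_sigma_algebraType G.

Lemma sub_history : <<s G >> `<=` measurable.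
Proof. by apply: smallest_sub => //; exact: sigma_algebra_measurable. Qed.

Lemma measurable_fun_g_sigma_algebra d (U : measurableType d) (f : Omega -> U) :
  measurable_fun setT (f : T -> U) -> measurable_fun setT f.
Proof.
by move=> mf _ A mA; apply: sub_history; apply: (mf measurableT A mA).
Qed.

(** The definition of a conditional density is an identity on rectangles [A]*[C] with [A] in the
    past. These form a generating class stable under intersection, so the law [m1] of [(w, Z w)] on
    [T * R] equals the measure [m2] with density [fD], and integrals of nonnegative functions agree
    too. *)
Lemma conditional_density_integral (nu : {measure set R -> \bar R}) (D : set R)
    (Z : {RV P >-> R}) (f : Omega -> R -> R) (g : T * R -> \bar R) :
  measurable D -> sigma_finite D nu ->
  conditional_density <<s G >> nu D Z f ->
  (forall w y, D y -> (0 <= f w y)%R) ->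
  measurable_fun setT (fun p : T * R => f p.1 p.2 * \1_D p.2)%R ->
  (forall p, 0 <= g p) -> measurable_fun setT g ->
  \int[P]_w g (w, Z w) = \int[P]_w \int[nu]_(y in D) (g (w, y) * (f w y)%:E).
Proof.
move=> mD sD cd f0 mfD g0 mg.
pose fD := fun p : T * R => (f p.1 p.2 * \1_D p.2)%R.
have fD0 p : (0 <= fD p)%R.
  rewrite /fD indicE; case: (boolP (p.2 \in D)) => [|_]; last by rewrite mulr0.
  by rewrite mulr1 inE; exact: f0.
have [nuD nuDI] := restricted_measure_ex mD sD.
(* The image of [P] under the identity from [Omega] to [T] is the restriction of [P] to the
   sub-sigma-algebra. *)
have mid : measurable_fun setT (id : Omega -> T).
  by move=> _ A mA; rewrite setTI; exact: sub_history.
have [P0 [P0E P0I]] := pushforward_measure_ex P mid.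
have sP0 : sigma_finite setT P0.
  exists (fun=> setT) => [|_]; first by rewrite bigcup_const//; exists 0%N.
  rewrite P0E; split => //; rewrite (_ : pushforward _ _ _ = 1) ?ltry//.
  exact: (probability_setT P).
have [P' P'E] := sigma_finite_measure_ex sP0.
have mp : measurable_fun setT (fun w : Omega => (w, Z w) : T * R).
  by apply/measurable_fun_pair.
have [m1 [m1E m1I]] := pushforward_measure_ex P mp.
have [m2 m2E] := density_measure_ex (P' \x nuD) fD0 mfD.
have section_int (h : T * R -> \bar R) : (forall p, 0 <= h p) ->
    measurable_fun setT h ->
    \int[P' \x nuD]_p (h p * (fD p)%:E) =
    \int[P]_w \int[nu]_(y in D) (h (w, y) * (f w y)%:E).
  move=> h0 mh.
  have mhf : measurable_fun setT (fun p => h p * (fD p)%:E).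
    by apply: emeasurable_funM => //; exact/measurable_EFinP.
  have hf0 p : 0 <= h p * (fD p)%:E by rewrite mule_ge0 ?lee_fin.
  rewrite fubini_tonelli1//= P'E P0I; last 2 first.
  - by move=> w; exact: integral_ge0.
  - exact: measurable_fun_fubini_tonelli_F.
  apply: eq_integral => w _; rewrite /fubini_F nuDI; last 2 first.
  - by move=> y; exact: (hf0 (w, y)).
  - exact: (measurableT_comp mhf (pair1_measurable (T1 := T) w)).
  by apply: eq_integral => y Dy; rewrite /fD/= indicE Dy mulr1.
have m12 : forall A, measurable A -> m1 A = m2 A.
  pose C : set (set (T * R)) :=
    [set E | exists A B, [/\ measurable A, measurable B & E = A `*` B]].
  apply: (measure_unique C (fun=> setT)).
  - rewrite measurable_prod_measurableType; congr (<<s _ >>).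
    apply/seteqP; split => [E [A mA [B mB <-]]|E [A [B [mA mB ->]]]].
      by exists A, B.
    by exists A => //; exists B.
  - move=> _ _ [A [B [mA mB ->]]] [A' [B' [mA' mB' ->]]].
    by exists (A `&` A'), (B `&` B'); rewrite setXI; split => //; exact: measurableI.
  - by move=> _; exists setT, setT; rewrite setXTT; split.
  - by rewrite bigcup_const//; exists 0%N.
  - move=> _ [A [B [mA mB ->]]].
    rewrite m1E m2E; transitivity (P (A `&` Z @^-1` B)) => //.
    rewrite (cd A B mA mB) (integral_indicM P A) [RHS](integral_indicM _ (A `*` B)).
    transitivity (\int[P' \x nuD]_p ((\1_(A `*` B) p)%:E * (fD p)%:E)); last first.
      by apply: eq_integral => p _; rewrite muleC.
    rewrite (section_int (fun p => (\1_(A `*` B) p)%:E))//; last first.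
      by apply/measurable_EFinP; apply: measurable_indic; exact: measurableX.
    apply: eq_integral => w _; rewrite setIC integral_mkcondl.
    under [RHS]eq_integral => y _.
      rewrite (_ : \1_(A `*` B) (w, y) = \1_A w * \1_B y :> R)%R; last first.
        by rewrite !indicE in_setX -natrM mulnb.
      over.
    rewrite epatch_indic /= indicE; case: (w \in A) => /=.
      rewrite mule1; apply: eq_integral => y _; by rewrite mul1r muleC.
    rewrite mule0 integral0_eq// => y _; by rewrite mul0r mul0e.
  - move=> _; rewrite m1E (_ : pushforward _ _ _ = 1) ?ltry//.
    exact: (probability_setT P).
rewrite -(section_int g)// -m1I// (eq_measure_integral m2); last by move=> A mA _; exact: m12.
by apply: ge0_integral_density => // A _; rewrite m2E.
Qed.

Lemma measurable_section_integral (nu : {measure set R -> \bar R}) (D : set R)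
    (f : Omega -> R -> R) (g : T * R -> \bar R) :
  measurable D -> sigma_finite D nu ->
  (forall w y, D y -> (0 <= f w y)%R) ->
  measurable_fun setT (fun p : T * R => f p.1 p.2 * \1_D p.2)%R ->
  (forall p, 0 <= g p) -> measurable_fun setT g ->
  measurable_fun setT
    (fun w : Omega => \int[nu]_(y in D) (g (w, y) * (f w y)%:E)).
Proof.
move=> mD sD f0 mfD g0 mg.
have [nuD nuDI] := restricted_measure_ex mD sD.
pose gf := fun p : T * R => g p * (f p.1 p.2 * \1_D p.2)%:E.
have gf0 p : 0 <= gf p.
  rewrite /gf mule_ge0// lee_fin indicE; have [pD|_] := boolP (p.2 \in D).
    by rewrite mulr1; apply: f0; rewrite inE in pD.
  by rewrite mulr0.
have mgf : measurable_fun setT gf.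
  by apply: emeasurable_funM => //; exact/measurable_EFinP.
rewrite [X in measurable_fun _ X](_ : _ = fun w => \int[nuD]_y gf (w, y)).
  apply: measurable_fun_g_sigma_algebra.
  exact: (measurable_fun_fubini_tonelli_F (m2 := nuD) gf).
apply/funext => w; rewrite nuDI; last 2 first.
- by move=> y; exact: gf0.
- exact: (measurableT_comp mgf (pair1_measurable (T1 := T) w)).
by apply: eq_integral => y yD; rewrite /gf indicE yD mulr1.
Qed.

Lemma measurable_fun_pair_RV d (U : measurableType d) (g : T * R -> U) (Z : {RV P >-> R}) :
  measurable_fun setT g -> measurable_fun setT (fun w : Omega => g (w, Z w)).
Proof.
move=> mg.
have mid : measurable_fun setT (id : Omega -> T).
  by move=> _ A mA; rewrite setTI; exact: sub_history.
have mp : measurable_fun setT (fun w : Omega => (w, Z w) : T * R).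
  by apply/measurable_fun_pair.
exact: (measurableT_comp mg mp).
Qed.

End conditional_density.

(** * Ville's inequality *)

Section ville.
Local Open Scope ereal_scope.
Context {R : realType} {dO : measure_display} {Omega : measurableType dO}.
Variables (P : probability Omega R) (N : nat -> Omega -> R) (c : R).

(** The event that [N] has not reached [c] strictly before time [n]. [A n.+1] is decided at time
    [n], and it is on these events that the supermartingale inequality is assumed. *)
Let A n := [set w | forall k, (k < n)%N -> (N k w < c)%R].

Hypotheses (c_gt0 : (0 < c)%R) (N_ge0 : forall n w, (0 <= N n w)%R).
Hypotheses (mN : forall n, measurable_fun setT (N n)).
Hypothesis N0 : \int[P]_w (N 0 w)%:E <= 1.
Hypothesis N_super : forall n,
  \int[P]_(w in A n.+1) (N n.+1 w)%:E <= \int[P]_(w in A n.+1) (N n w)%:E.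

Let AS n : A n.+1 = A n `&` [set w | (N n w < c)%R].
Proof.
apply/seteqP; split => [w Aw|w [Aw Nw] k]; last first.
  by rewrite ltnS leq_eqVlt => /predU1P[->//|]; exact: Aw.
split; last exact: Aw.
by move=> k kn; apply: Aw; rewrite ltnW.
Qed.

Let mlt n : measurable [set w | (N n w < c)%R].
Proof.
rewrite (_ : [set w | _] = N n @^-1` `]-oo, c[%classic).
  by rewrite -[X in measurable X]setTI; exact: mN.
by apply/seteqP; split => w /=; rewrite in_itv.
Qed.

Let mA n : measurable (A n).
Proof.
elim: n => [|n IH]; last by rewrite AS; exact: measurableI.
by rewrite (_ : A 0%N = setT)//; apply/seteqP; split.
Qed.

(** The left side is a lower bound on the expectation of [N] stopped when it first reaches [c]. From
    [n] to [n.+1] the mass of [C], where [c] is first reached at time [n], moves to the first term;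
    this is paid for by [c <= N n] on [C]. *)
Lemma ville_stopped n : c%:E * P (~` A n) + \int[P]_(w in A n) (N n w)%:E <= 1.
Proof.
elim: n => [|n IH].
  rewrite (_ : A 0%N = setT); last by apply/seteqP; split.
  by rewrite setCT measure0 mule0 add0e.
apply: le_trans IH; pose C := A n `\` A n.+1.
have mC : measurable C by exact: measurableD.
have -> : ~` A n.+1 = ~` A n `|` C.
  apply/seteqP; split => w; last by case=> [|[]//] /=; rewrite AS => + [].
  by move=> nA; have [Aw|] := pselect (A n w); [right|left].
have EA : A n = A n.+1 `|` C.
  apply/seteqP; split => w.
    by move=> Aw; have [Aw'|] := pselect (A n.+1 w); [left|right].
  by case=> [|[]//]; rewrite AS => -[].
have mE k D : measurable_fun D (fun w => (N k w)%:E).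
  by apply/measurable_funTS/measurable_EFinP; exact: mN.
have E0 k w : 0 <= (N k w)%:E by rewrite lee_fin.
rewrite measureU//; [|exact: measurableC|]; last first.
  by apply/seteqP; split => // w [/= nAw [Aw _]].
have -> : \int[P]_(w in A n) (N n w)%:E =
    \int[P]_(w in A n.+1) (N n w)%:E + \int[P]_(w in C) (N n w)%:E.
  rewrite {1}EA ge0_integral_setU//.
  by rewrite disj_set2E; apply/eqP/seteqP; split => // w [Aw [_]].
rewrite muleDr// ?ge0_adde_def ?inE// -addeA; apply: leeD => //.
rewrite addeC; apply: leeD => //.
have -> : c%:E * P C = \int[P]_(w in C) c%:E by rewrite integral_cst.
apply: ge0_le_integral => //.
- by move=> w _; rewrite lee_fin ltW.
- move=> w [Aw nAw]; rewrite lee_fin leNgt; apply: contra_notN nAw => Nw.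
  by rewrite AS.
Qed.

Lemma ville : P [set w | exists n, (c <= N n w)%R] <= (c^-1)%:E.
Proof.
have ltP n : P (~` A n) <= (c^-1)%:E.
  rewrite -(@lee_pmul2l _ c%:E)//.
  rewrite -EFinM divff ?gt_eqF//; apply: le_trans (ville_stopped n).
  by rewrite leeDl// integral_ge0// => w _; rewrite lee_fin.
have -> : [set w | exists n, (c <= N n w)%R] = \bigcup_n ~` A n.
  apply/seteqP; split => [w [n cN]|w [n _ /existsNP[k /not_implyP[_]]]].
    by exists n.+1 => // /(_ n (ltnSn _)); rewrite ltNge cN.
  by move=> /negP; rewrite -leNgt => cN; exists k.
have mCA n : measurable (~` A n) by exact: measurableC.
have nd : nondecreasing_seq (fun n => ~` A n).
  move=> i j ij; apply/subsetPset/subsetC => w Aw k ki.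
  by apply: Aw; exact: leq_trans ij.
have cv := nondecreasing_cvg_mu mCA (bigcupT_measurable _ mCA) nd (mu := P).
rewrite -(cvg_lim _ cv)//; apply: lime_le; first by apply/cvg_ex; eexists; exact: cv.
by apply: nearW => n; exact: ltP.
Qed.

End ville.

(** * The evidence of the prior *)

Section dot_product.
Context {R : realType} {d : nat}.
Implicit Types (u x : d.-tuple R).

Lemma dotp_shift u x i v : dotp (shift_coord u i v) x = dotp u x + v * tnth x i.
Proof.
rewrite /dotp (bigD1 i)//= [in RHS](bigD1 i)//= tnth_mktuple eqxx.
rewrite mulrDl -!addrA; congr (_ + _); rewrite addrC; congr (_ + _).
by apply: eq_bigr => j /negbTE ji; rewrite tnth_mktuple ji addr0.
Qed.

Lemma dotp_shift_sqr u i v :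
  dotp (shift_coord u i v) (shift_coord u i v) = dotp u u + 2 * v * tnth u i + v ^+ 2.
Proof.
have C (a c : d.-tuple R) : dotp a c = dotp c a.
  by apply: eq_bigr => j _; rewrite mulrC.
rewrite dotp_shift C dotp_shift tnth_mktuple eqxx; ring.
Qed.

Lemma norm_tnth_le x i : `|tnth x i| <= norm_oo x.
Proof. by rewrite /norm_oo; apply: le_bigmax_cond. Qed.

(** Young's inequality, one coordinate at a time by completing a square. It absorbs a linear term
    into an arbitrarily small multiple of the squared norm. *)
Lemma norm_dotp_le (A e : R) u x : 0 < e -> 0 <= A ->
  A * `|dotp u x| <= e * dotp u u + A ^+ 2 * dotp x x / (4 * e).
Proof.
move=> e0 A0; rewrite /dotp.
have le1 : A * `|\sum_i tnth u i * tnth x i| <= \sum_i A * `|tnth u i * tnth x i|.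
  by rewrite -mulr_sumr ler_wpM2l// ler_norm_sum.
apply: (le_trans le1); rewrite !mulr_sumr mulr_suml -big_split/=.
apply: ler_sum => i _; set a := tnth u i; set c := tnth x i.
rewrite normrM -[a * a]/(a ^+ 2) -[c * c]/(c ^+ 2).
rewrite -(real_normK (num_real a)) -(real_normK (num_real c)) -subr_ge0.
move: `|a| `|c| => {}a {}c.
have -> : e * a ^+ 2 + A ^+ 2 * c ^+ 2 / (4 * e) - A * (a * c) =
    e * (a - A * c / (2 * e)) ^+ 2.
  by field; rewrite gt_eqF.
by rewrite mulr_ge0 ?sqr_ge0 ?ltW.
Qed.

End dot_product.

(** For [z >= 0] the point 0 is a convex combination of [- a] and [z * a], with weights proportional
    to [z] and 1, which bounds [psi (z * a)] below by an affine function of [z]. The choices [a = 1]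
    and [a = - 1] cover the two half-lines. *)
Lemma convex_ge_norm {R : realType} (psi : R -> R) :
  convex_function [set: R^o] (psi : R^o -> R^o) ->
  exists2 C, 0 <= C & forall z, psi 0 - C * `|z| <= psi z.
Proof.
move=> cvx.
have H a z : 0 <= z -> psi 0 + z * (psi 0 - psi (- a)) <= psi (z * a).
  move=> z0; have z1 : 0 < 1 + z by lra.
  have ht : 0 <= z / (1 + z) <= 1.
    apply/andP; split; first exact: divr_ge0 z0 (ltW z1).
    by rewrite ler_pdivrMr// mul1r; lra.
  have := convex_functionP cvx (- a) (z * a) ht.
  have -> : z / (1 + z) * - a + (1 - z / (1 + z)) * (z * a) = 0.
    by field; rewrite gt_eqF.
  have -> : z / (1 + z) * psi (- a) + (1 - z / (1 + z)) * psi (z * a) =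
      (z * psi (- a) + psi (z * a)) / (1 + z) by field; rewrite gt_eqF.
  by rewrite ler_pdivlMr//; lra.
exists (`|psi 0 - psi (- 1)| + `|psi 0 - psi 1|) => [|z]; first by rewrite addr_ge0.
set p := psi 0 - psi (- 1); set q := psi 0 - psi 1.
have [z0|/ltW z0] := leP 0 z.
  have := H 1 z z0; rewrite mulr1 -/p (ger0_norm z0); apply: le_trans.
  rewrite -mulNr lerD2l mulrC ler_wpM2l//.
  by rewrite lerNl; have := ler_norm (- p); rewrite normrN; have := normr_ge0 q; lra.
have := H (- 1) (- z); rewrite oppr_ge0 mulrN1 !opprK -/q => /(_ z0).
rewrite (ler0_norm z0); apply: le_trans.
rewrite -mulNr lerD2l mulrC ler_wpM2l ?oppr_ge0//.
by rewrite lerNl; have := ler_norm (- q); rewrite normrN; have := normr_ge0 p; lra.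
Qed.

Section likelihood.
Context {R : realType} {d : nat}.
Variables (psi : R -> R) (t0 : d.-tuple R).
Implicit Types (x : d.-tuple R) (y : R) (u : d.-tuple R).
Implicit Types (xs : nat -> d.-tuple R) (ys : nat -> R).

(* Half the log-likelihood ratio of u against t0 for the observation (x, y);
   the factor h(y) cancels. *)
Definition half_llr x y u : R :=
  2^-1 * ((dotp u x - dotp t0 x) * y - psi (dotp u x) + psi (dotp t0 x)).

(** The weight W_n, for arbitrary data sequences [xs] and [ys]. *)
Definition sqrt_lik xs ys n u : R :=
  expR (\sum_(1 <= k < n.+1) half_llr (xs k) (ys k) u).

Lemma sqrt_lik_gt0 xs ys n u : 0 < sqrt_lik xs ys n u.
Proof. exact: expR_gt0. Qed.

Lemma sqrt_likS xs ys n u :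
  sqrt_lik xs ys n.+1 u =
  sqrt_lik xs ys n u * expR (half_llr (xs n.+1) (ys n.+1) u).
Proof. by rewrite /sqrt_lik big_nat_recr//= expRD. Qed.

Hypothesis psi_cvx : convex_function [set: R^o] (psi : R^o -> R^o).
Hypothesis mpsi : measurable_fun setT psi.

Lemma measurable_half_llr dT (T : measurableType dT) (f : T -> d.-tuple R)
    (g : T -> R) (v : T -> d.-tuple R) :
  measurable_fun setT f -> measurable_fun setT g -> measurable_fun setT v ->
  measurable_fun setT (fun p => half_llr (f p) (g p) (v p)).
Proof.
move=> mf mg mv; apply: measurable_funM => //.
have mz (v' : T -> d.-tuple R) : measurable_fun setT v' ->
    measurable_fun setT (fun p => dotp (v' p) (f p)).
  by move=> mv'; exact: measurable_dotp.
have mt0 : measurable_fun setT (fun _ : T => t0) by exact: measurable_cst.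
apply: measurable_funD; last exact: (measurableT_comp mpsi (mz _ mt0)).
apply: measurable_funB; last exact: (measurableT_comp mpsi (mz _ mv)).
by apply: measurable_funM => //; apply: measurable_funB; exact: mz.
Qed.

Lemma measurable_sqrt_lik dT (T : measurableType dT) n
    (xs : T -> nat -> d.-tuple R) (ys : T -> nat -> R) (v : T -> d.-tuple R) :
  (forall k, (1 <= k <= n)%N -> measurable_fun setT (xs ^~ k)) ->
  (forall k, (1 <= k <= n)%N -> measurable_fun setT (ys ^~ k)) ->
  measurable_fun setT v ->
  measurable_fun setT (fun p => sqrt_lik (xs p) (ys p) n (v p)).
Proof.
move=> mx my mv; apply: measurableT_comp => //.
elim: n mx my => [|n IH] mx my.
  by under eq_fun do rewrite big_geq//; exact: measurable_cst.
under eq_fun do rewrite big_nat_recr//=.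
apply: measurable_funD.
  by apply: IH => k /andP[k1 kn]; [apply: mx|apply: my]; rewrite k1 leqW.
by apply: measurable_half_llr; [apply: mx|apply: my|]; rewrite ?leqnn.
Qed.

(** Since [psi] decreases at most linearly, each term grows at most linearly in [dotp u x], and
    [norm_dotp_le] absorbs it into a multiple of the squared norm; [e] is halved at each induction
    step. This makes the evidence finite whatever the data. *)
Lemma half_llr_dominated xs ys n (e : R) : 0 < e ->
  exists K, forall u,
    \sum_(1 <= k < n.+1) half_llr (xs k) (ys k) u <= K + e * dotp u u.
Proof.
have [C C0 HC] := convex_ge_norm psi_cvx.
elim: n e => [|n IH] e e0.
  by exists 0 => u; rewrite big_geq// add0r mulr_ge0 ?dotp_ge0// ltW.
have e2 : 0 < e / 2 by rewrite divr_gt0.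
have [K HK] := IH _ e2.
set x := xs n.+1; set y := ys n.+1; set z0 := dotp t0 x.
pose A := `|y| + C; have A0 : 0 <= A by rewrite addr_ge0.
exists (K + (2^-1 * (- z0 * y - psi 0 + psi z0) + A ^+ 2 * dotp x x / (4 * (e / 2)))).
move=> u; rewrite big_nat_recr//=.
have : half_llr x y u <= 2^-1 * (- z0 * y - psi 0 + psi z0) + A * `|dotp u x|.
  rewrite /half_llr -/z0; set z := dotp u x.
  have h1 := HC z.
  have h2 : z * y <= `|z| * `|y| by rewrite -normrM ler_norm.
  have -> : A * `|z| = `|z| * `|y| + C * `|z| by rewrite /A; ring.
  have h3 : 0 <= `|z| * `|y| by rewrite mulr_ge0.
  have h4 : 0 <= C * `|z| by rewrite mulr_ge0.
  rewrite mulrBl mulNr; move: h1 h2 h3 h4.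
  move: (z * y) (`|z| * `|y|) (C * `|z|) (z0 * y) => a1 a2 a3 a4; lra.
have := norm_dotp_le u x e2 A0.
have := HK u; rewrite -/x -/y.
by move: (dotp u u) => D; lra.
Qed.

Local Notation rho B := (fun u : d.-tuple R => norm2 u ^+ 2 / (2 * B ^+ 2)).
Local Notation prior_int B g := (\sum_(S : {set 'I_d}) (subset_weight S)%:E *
     (((Num.sqrt (2 * pi * B ^+ 2) ^+ #|S|)^-1)%:E *
      \int[@lebesgue_tuple R #|S|]_v
        ((g (embed_coords v))%:E * (expR (- rho B (embed_coords v)))%:E)))%E.

Let msl xs ys n (S : {set 'I_d}) :
  measurable_fun setT (fun v : #|S|.-tuple R => sqrt_lik xs ys n (embed_coords v)).
Proof.
apply: measurable_sqrt_lik; [by move=> k _; exact: measurable_cst..|].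
exact: measurable_embed_coords.
Qed.

Let mrho B (S : {set 'I_d}) :
  measurable_fun setT (fun v : #|S|.-tuple R => rho B (embed_coords v)).
Proof. exact: (measurableT_comp (measurable_rho B) (@measurable_embed_coords _ _ S)). Qed.

Lemma prior_sqrt_lik_lty B xs ys n : 0 < B ->
  (prior_int B (sqrt_lik xs ys n) < +oo)%E.
Proof.
move=> B0; apply: lte_sum_pinfty => S _.
have c0 : 0 < (2 * B ^+ 2)^-1 by rewrite invr_gt0 mulr_gt0 ?exprn_gt0.
(* Half of the coefficient of [dotp u u] in the prior exponent is spent on the likelihood; the other
   half keeps the integral Gaussian. *)
have e0 : 0 < (4 * B ^+ 2)^-1 by rewrite invr_gt0 mulr_gt0 ?exprn_gt0.
have [K HK] := half_llr_dominated xs ys n e0.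
have [M ME] := @lebesgue_tuple_measure_ex R #|S|.
apply: lte_mul_pinfty; [by rewrite lee_fin ltW ?subset_weight_gt0|by []|].
apply: lte_mul_pinfty; [by rewrite lee_fin invr_ge0 exprn_ge0 ?sqrtr_ge0|by []|].
rewrite -ME.
apply: (@le_lt_trans _ _ (\int[M]_v ((expR K)%:E *
   (expR (- ((2 * B ^+ 2)^-1 * dotp v v / 2)))%:E))%E).
  apply: ge0_le_integral => //.
  - by move=> v _; rewrite mule_ge0 ?lee_fin ?expR_ge0.
  - apply: emeasurable_funM; first (apply/measurable_EFinP; exact: msl).
    exact: (measurable_expRN (mrho B (S:=S))).
  - apply: emeasurable_funM => //; apply: measurable_expRN.
    by do 2 apply: measurable_funM => //; exact: measurable_dotp.
  move=> v _; rewrite -!EFinM lee_fin -!expRD ler_expR.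
  rewrite norm2_sqr !dotp_embed_coords.
  have := HK (embed_coords v); rewrite dotp_embed_coords.
  have -> : dotp v v / (2 * B ^+ 2) = 2 * ((4 * B ^+ 2)^-1 * dotp v v).
    by field; rewrite gt_eqF.
  have -> : (2 * B ^+ 2)^-1 * dotp v v / 2 = (4 * B ^+ 2)^-1 * dotp v v.
    by field; rewrite gt_eqF.
  by move: (_ * dotp v v) => D; lra.
rewrite ge0_integralZl_EFin ?expR_ge0//; last first.
  by apply: measurable_expRN; do 2 apply: measurable_funM => //; exact: measurable_dotp.
by rewrite /= ME integral_gaussian_tuple// -EFinM ltry.
Qed.

(** The square root is what remains of [(2 * pi / c)] over the prior normaliser [2 * pi * B ^+ 2],
    as [c * B ^+ 2 = 1 + M * B ^+ 2 * L ^+ 2 * n / 2]. The factor [expR (- 2^-1)] is the cost of the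
    prior exponent at [t0], where W_n equals 1. *)
Lemma prior_sqrt_lik_ge B L M xs ys n : 0 < B -> 0 < L -> 0 < M ->
  smooth M psi -> norm2 t0 <= B ->
  (forall k, (1 <= k <= n)%N -> norm_oo (xs k) <= L) ->
  ((subset_weight (supp t0) *
   (Num.sqrt (1 + M * B ^+ 2 * L ^+ 2 * n%:R / 2) ^- #|supp t0| *
    expR (- 2^-1)))%:E <= prior_int B (sqrt_lik xs ys n))%E.
Proof.
move=> B0 L0 M0 sm tB xL; set S := supp t0.
have int_ge0 (S' : {set 'I_d}) : (0 <= (subset_weight S')%:E *
     (((Num.sqrt (2 * pi * B ^+ 2) ^+ #|S'|)^-1)%:E *
      \int[@lebesgue_tuple R #|S'|]_v
        ((sqrt_lik xs ys n (embed_coords v))%:E *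
         (expR (- rho B (embed_coords v)))%:E)))%E.
  apply: mule_ge0; first by rewrite lee_fin ltW ?subset_weight_gt0.
  apply: mule_ge0; first by rewrite lee_fin invr_ge0 exprn_ge0 ?sqrtr_ge0.
  have [M' ME'] := @lebesgue_tuple_measure_ex R #|S'|; rewrite -ME'.
  by apply: integral_ge0 => v _; rewrite mule_ge0 ?lee_fin ?expR_ge0.
rewrite (bigD1 S)//=; apply: le_trans (leeDl _ _); last by apply: sume_ge0 => S' _.
rewrite EFinM; apply: lee_wpmul2l; first by rewrite lee_fin ltW ?subset_weight_gt0.
(* Curvature of [F] along an axis: [(B ^+ 2)^-1] from the prior, and at most [M * L ^+ 2 / 2] from
   each of the [n] observations. *)
pose c := M * n%:R * L ^+ 2 / 2 + (B ^+ 2)^-1.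
have c0 : 0 < c.
  by rewrite ltr_wpDl ?invr_gt0 ?exprn_gt0// divr_ge0// mulr_ge0 ?sqr_ge0// mulr_ge0// ltW.
pose F (v : #|S|.-tuple R) := rho B (embed_coords v) -
  \sum_(1 <= k < n.+1) half_llr (xs k) (ys k) (embed_coords v).
pose v0 := [tuple tnth t0 (enum_val i) | i < #|S|].
have ev0 : embed_coords v0 = t0 by exact: embed_restrict.
have F0 : F v0 <= 2^-1.
  rewrite /F ev0 big1 ?subr0; last first.
    by move=> k _; rewrite /half_llr subrr mul0r sub0r addNr mulr0.
  rewrite ler_pdivrMr ?mulr_gt0 ?exprn_gt0// mulrA mulVf// mul1r.
  by rewrite ler_sqr ?nnegrE ?sqrtr_ge0// ltW.
have mF : measurable_fun setT F.
  apply: measurable_funB; first exact: mrho.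
  rewrite [X in measurable_fun _ X](_ : _ = fun v => ln (sqrt_lik xs ys n (embed_coords v))).
    by apply: measurableT_comp => //; exact: msl.
  by apply/funext => v; rewrite expRK.
have HF i v a : F (shift_coord v i a) + F (shift_coord v i (- a)) <= 2 * F v + c * a ^+ 2.
  rewrite /F !norm2_sqr !embed_shift_coord !dotp_shift_sqr.
  set w := embed_coords v; set j := enum_val i.
  have : \sum_(1 <= k < n.+1) (2 * half_llr (xs k) (ys k) w - M * L ^+ 2 / 2 * a ^+ 2) <=
     \sum_(1 <= k < n.+1) (half_llr (xs k) (ys k) (shift_coord w j a) +
                           half_llr (xs k) (ys k) (shift_coord w j (- a))).
    rewrite big_nat [leRHS]big_nat; apply: ler_sum => k kn.
    rewrite /half_llr !dotp_shift mulNr; set z := dotp w _; set dl := a * _.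
    have h1 := smooth_midpoint z dl sm.
    have h2 : dl ^+ 2 <= L ^+ 2 * a ^+ 2.
      rewrite /dl exprMn mulrC ler_wpM2r ?sqr_ge0//.
      rewrite -(real_normK (num_real (tnth _ _))) ler_sqr ?nnegrE// ?(ltW L0)//.
      by apply: le_trans (norm_tnth_le _ _) _; exact: xL.
    have h3 : M * dl ^+ 2 <= M * (L ^+ 2 * a ^+ 2) by rewrite ler_wpM2l// ltW.
    have -> : M * L ^+ 2 / 2 * a ^+ 2 = M * (L ^+ 2 * a ^+ 2) / 2 by field.
    move: (M * (L ^+ 2 * a ^+ 2)) h1 h3 => K.
    move: (psi (z + dl)) (psi (z - dl)) (psi z) (psi _) (M * dl ^+ 2) => p1 p2 p3 p4 D.
    by clear; move: (ys k) (dotp t0 _) dl => y z0 e; lra.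
  rewrite sumrB !big_split/= -mulr_sumr sumr_const_nat subSS subn0.
  rewrite -(mulr_natl (M * L ^+ 2 / 2 * a ^+ 2)).
  move: (\sum_(1 <= k < n.+1) _) (\sum_(1 <= k < n.+1) _) (\sum_(1 <= k < n.+1) _) => s1 s2 s3.
  move=> h; have -> : c * a ^+ 2 = n%:R * (M * L ^+ 2 / 2 * a ^+ 2) + 2 * a ^+ 2 / (2 * B ^+ 2).
    by rewrite /c; field; rewrite gt_eqF.
  have -> : (dotp w w + 2 * a * tnth w j + a ^+ 2) / (2 * B ^+ 2) =
    dotp w w / (2 * B ^+ 2) + (2 * a * tnth w j) / (2 * B ^+ 2) + a ^+ 2 / (2 * B ^+ 2).
    by rewrite !mulrDl.
  have -> : (dotp w w + 2 * - a * tnth w j + (- a) ^+ 2) / (2 * B ^+ 2) =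
    dotp w w / (2 * B ^+ 2) - (2 * a * tnth w j) / (2 * B ^+ 2) + a ^+ 2 / (2 * B ^+ 2).
    by field; rewrite gt_eqF.
  have -> : 2 * a ^+ 2 / (2 * B ^+ 2) = 2 * (a ^+ 2 / (2 * B ^+ 2)) by rewrite mulrA.
  by lra.
have H := integral_expRN_tuple_ge v0 c0 mF HF.
have [N NE] := @lebesgue_tuple_measure_ex R #|S|.
have -> : (\int[@lebesgue_tuple R #|S|]_v
        ((sqrt_lik xs ys n (embed_coords v))%:E *
         (expR (- rho B (embed_coords v)))%:E) =
    \int[@lebesgue_tuple R #|S|]_v (expR (- F v))%:E)%E.
  rewrite -NE; apply: eq_integral => v _.
  by rewrite -EFinM -expRD /F opprB.
apply: le_trans (lee_wpmul2l _ H); last by rewrite lee_fin invr_ge0 exprn_ge0 ?sqrtr_ge0.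
have lin0 : 0 < 1 + M * B ^+ 2 * L ^+ 2 * n%:R / 2.
  by rewrite ltr_wpDr// divr_ge0// !mulr_ge0 ?exprn_ge0// ltW.
have tau0 : 0 < 2 * pi * B ^+ 2 by rewrite !mulr_gt0 ?pi_gt0 ?exprn_gt0.
have cE : 2 * pi / c = 2 * pi * B ^+ 2 / (1 + M * B ^+ 2 * L ^+ 2 * n%:R / 2).
  rewrite -[in RHS](_ : c * B ^+ 2 = 1 + M * B ^+ 2 * L ^+ 2 * n%:R / 2).
    by field; rewrite !gt_eqF.
  by rewrite /c; field; rewrite gt_eqF.
rewrite -EFinM lee_fin cE.
rewrite [Num.sqrt (_ / _)]sqrtrM ?(ltW tau0)// sqrtrV ?(ltW lin0)// exprMn.
rewrite -(mulrA (Num.sqrt (2 * pi * B ^+ 2) ^+ _)) mulKf; last first.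
  by rewrite expf_neq0// gt_eqF// sqrtr_gt0.
rewrite exprVn; apply: ler_wpM2l; first by rewrite invr_ge0 exprn_ge0 ?sqrtr_ge0.
by rewrite ler_expR lerN2.
Qed.

End likelihood.

(** * One step of the forecaster *)

Lemma integral_gt0_probability dT (T : measurableType dT) (R : realType)
    (Q : {measure set T -> \bar R}) (w : T -> R) :
  Q setT = 1%E -> (forall u, 0 < w u) -> measurable_fun setT w ->
  (0 < \int[Q]_u (w u)%:E)%E.
Proof.
move=> Q1 w0 mw; rewrite lt_neqAle integral_ge0 ?andbT; last first.
  by move=> u _; rewrite lee_fin ltW.
apply/eqP => I0.
have mE : measurable_fun setT (fun u => (w u)%:E) by exact/measurable_EFinP.
have := @ae_eq_integral_abs _ _ _ Q _ measurableT _ mE.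
under eq_integral do rewrite gee0_abs ?lee_fin ?ltW//.
rewrite -I0 => -[/(_ erefl) + _].
case=> Z [mZ QZ sZ].
suff : (Q setT <= Q Z)%E by rewrite Q1 QZ lee_fin ler10.
rewrite le_measure ?inE// => u _; apply: sZ => /= /(_ Logic.I) /eqP.
by rewrite eqe gt_eqF.
Qed.

(* The tangent of x |-> exp (c (x - a)^2) at the weighted mean of g lies below
   the function. *)
Lemma jensen_exp_sqr dT (T : measurableType dT) (R : realType)
    (Q : {measure set T -> \bar R}) (w g : T -> R) (b a c I J : R) :
  (forall u, 0 <= w u) -> measurable_fun setT w -> measurable_fun setT g ->
  (forall u, `|g u| <= b) -> 0 <= c -> 0 < I ->
  (\int[Q]_u (w u)%:E = I%:E)%E ->
  (\int[Q]_u ((g u + b) * w u)%:E = J%:E)%E ->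
  ((I * expR (c * (a - (J / I - b)) ^+ 2))%:E <=
   \int[Q]_u (w u * expR (c * (g u - a) ^+ 2))%:E)%E.
Proof.
move=> w0 mw mg gb c0 I0 wI gJ; set mu := J / I - b.
have mE : measurable_fun setT (fun u => w u * expR (c * (g u - a) ^+ 2)).
  apply: measurable_funM => //; apply: measurableT_comp => //.
  by apply: measurable_funM => //; apply: measurable_funX; exact: measurable_funB.
have f0 u : 0 <= w u * expR (c * (g u - a) ^+ 2) by rewrite mulr_ge0 ?expR_ge0.
have gb0 u : 0 <= (g u + b) * w u.
  by rewrite mulr_ge0//; have := gb u; rewrite ler_norml => /andP[]; lra.
have mgb : measurable_fun setT (fun u => (g u + b) * w u).
  by apply: measurable_funM => //; exact: measurable_funD.
have int (f : T -> R) (K : R) : (forall u, 0 <= f u) -> measurable_fun setT f ->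
    (\int[Q]_u (f u)%:E = K%:E)%E -> Q.-integrable setT (EFin \o f).
  move=> f_ge0 mf fK; apply/integrableP; split; first exact/measurable_EFinP.
  under eq_integral do rewrite /= ger0_norm//.
  by rewrite fK ltry.
(* An infinite right-hand side leaves nothing to prove; a finite one makes the integrand integrable,
   as monotonicity for signed integrands requires. *)
case Eint : (\int[Q]_u (w u * expR (c * (g u - a) ^+ 2))%:E)%E => [K| |].
- rewrite -Eint.
  (* The tangent at [mu] is [E * (1 + k * (x - mu))]; [al] and [be] are its coefficients in the two
     functions with known integrals, [w] and [(g + b) * w]. *)
  pose E := expR (c * (mu - a) ^+ 2); pose k := 2 * c * (mu - a).
  pose al := E * (1 - k * (mu + b)); pose be := E * k.
  have iw := int _ _ w0 mw wI; have ig := int _ _ gb0 mgb gJ.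
  have iE := int _ _ f0 mE Eint.
  have Elin : (\int[Q]_u (al * w u + be * ((g u + b) * w u))%:E =
     (I * expR (c * (a - mu) ^+ 2))%:E)%E.
    under eq_integral do rewrite EFinD (EFinM al) (EFinM be).
    rewrite integralD//; [|exact: integrableZl..].
    rewrite !integralZl// wI gJ -!EFinM -EFinD; congr (_%:E).
    have -> : (a - mu) ^+ 2 = (mu - a) ^+ 2 by ring.
    rewrite -/E /al /be.
    have -> : J = (mu + b) * I by rewrite /mu subrK divfK// gt_eqF.
    by ring.
  rewrite -Elin; apply: le_integral => //.
    apply: (eq_integrable _ (fun u => al%:E * (w u)%:E + be%:E * ((g u + b) * w u)%:E)%E) => //.
    by apply: integrableD => //; exact: integrableZl.
  move=> u _; rewrite lee_fin.
  have -> : al * w u + be * ((g u + b) * w u) = w u * (E * (1 + k * (g u - mu))).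
    by rewrite /al /be; ring.
  apply: ler_wpM2l => //.
  have -> : c * (g u - a) ^+ 2 = c * (mu - a) ^+ 2 + c * ((g u - a) ^+ 2 - (mu - a) ^+ 2).
    by ring.
  rewrite expRD -/E ler_wpM2l ?expR_ge0//.
  apply: le_trans (expR_ge1Dx _); rewrite lerD2l -subr_ge0.
  have -> : c * ((g u - a) ^+ 2 - (mu - a) ^+ 2) - k * (g u - mu) = c * (g u - mu) ^+ 2.
    by rewrite /k; ring.
  by rewrite mulr_ge0// sqr_ge0.
- by rewrite leey.
- have : (0 <= \int[Q]_u (w u * expR (c * (g u - a) ^+ 2))%:E)%E.
    by apply: integral_ge0 => u _; rewrite lee_fin.
  by rewrite Eint leeNy_eq.
Qed.

Section one_step.
Context {R : realType} {d : nat}.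
Variables (psi h : R -> R) (t0 : d.-tuple R) (nu : {measure set R -> \bar R}).
Variables (Ycal : set R) (b m M : R).
Hypotheses (d_gt0 : (1 <= d)%N) (mYcal : measurable Ycal).
Hypotheses (nu_sigma_finite : sigma_finite Ycal nu).
Hypotheses (h_ge0 : forall y, Ycal y -> 0 <= h y).
Hypothesis psi_cvx : convex_function [set: R^o] (psi : R^o -> R^o).
Hypothesis mpsi : measurable_fun setT psi.
Hypothesis glm_densityP : forall x theta : d.-tuple R,
    probability_density nu Ycal (glm_density psi h x theta).
Hypotheses (b_gt0 : 0 < b) (m_gt0 : 0 < m) (psi_smooth : smooth M psi).
Hypothesis psi_sc : strongly_convex_on `[- b, b] m psi.

(** The density hypothesis speaks of parameters [dotp theta x]. As [d >= 1], these exhaust the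
    reals, so every natural parameter is available, midpoints included. *)
Lemma dotp_onto z : exists x u : d.-tuple R, dotp u x = z.
Proof.
case: d d_gt0 => // n _.
exists [tuple of 1 :: nseq n 0], [tuple of z :: nseq n 0].
rewrite dotp_cons mulr1 /dotp big1 ?addr0// => i _.
by rewrite !(tnth_nth 0)/= nth_nseq if_same mul0r.
Qed.

Lemma exp_family_density z : probability_density nu Ycal
  (fun y => expR (z * y - psi z) * h y).
Proof. by have [x [u <-]] := dotp_onto z; exact: glm_densityP. Qed.

Lemma measurable_base_density : measurable_fun setT (fun y => h y * \1_Ycal y).
Proof.
have [mh _ _] := exp_family_density 0.
have {}mh : measurable_fun Ycal h.
  rewrite (_ : h = fun y => expR (psi 0) * (expR (0 * y - psi 0) * h y)).
    by apply: measurable_funM => //; exact: mh.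
  by apply/funext => y; rewrite mul0r sub0r mulrA -expRD subrr expR0 mul1r.
rewrite (_ : (fun y => _) = h \_ Ycal); first by apply/(measurable_restrictT h mYcal).
by rewrite patch_indic.
Qed.

(** The left side is the logarithm of the Bhattacharyya affinity of the densities with parameters
    [z] and [w]. Truncating [z] only shrinks the Jensen gap ([convex_midpoint_gap]), and inside
    [[- b, b]] strong convexity bounds it. *)
Lemma bhattacharyya_gap z w : `|w| <= b ->
  psi ((z + w) / 2) - 2^-1 * psi z - 2^-1 * psi w <= - (m / 8 * (trunc b z - w) ^+ 2).
Proof.
move=> wb.
have tb : `|trunc b z| <= b by exact: trunc_norm_le.
suff H : psi (trunc b z) + psi w - 2 * psi ((trunc b z + w) / 2) <=
    psi z + psi w - 2 * psi ((z + w) / 2).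
  have := strongly_convex_midpoint psi_smooth psi_sc tb wb.
  have -> : m / 8 * (trunc b z - w) ^+ 2 = (m / 4 * (trunc b z - w) ^+ 2) / 2 by field.
  by move: (m / 4 * _) => K; lra.
have [zb|bz] := leP `|z| b; first by rewrite trunc_id.
move: (wb); rewrite ler_norml => /andP[bw wb'].
have [z0|z0] := leP 0 z.
  have bz' : b <= z by rewrite -(ger0_norm z0) ltW.
  rewrite /trunc (min_idPr bz') (max_idPl _); last by lra.
  exact: convex_midpoint_gap.
have zb : z <= - b by rewrite lerNr -(ltr0_norm z0) ltW.
have zb' : z <= b by move: zb b_gt0; lra.
have -> : trunc b z = - b by rewrite /trunc (min_idPl zb') (max_idPr zb).
(* Truncation at [- b] is truncation at [b] for the reflected function. *)
pose psiN x := psi (- x).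
have cN : convex_function [set: R^o] (psiN : R^o -> R^o).
  by move=> t x y _ _; rewrite /psiN convN; apply: psi_cvx; rewrite inE.
have := convex_midpoint_gap (w := - w) (b := b) (z := - z) cN.
rewrite /psiN !opprK; have -> : - ((b + - w) / 2) = (- b + w) / 2 by field.
have -> : - ((- z + - w) / 2) = (z + w) / 2 by field.
by apply; lra.
Qed.

(** Tonelli's theorem puts the integral over the label inside. For fixed [u] that integral is [V u]
    times the Bhattacharyya affinity times the exponential correction, and [bhattacharyya_gap] says
    that the last two multiply to at most 1. [V] stands for a weight fixed by the past. *)
Lemma one_step (Q : {sigma_finite_measure set (d.-tuple R) -> \bar R}) x
    (V : d.-tuple R -> R) : `|dotp t0 x| <= b ->
  (forall u, 0 <= V u) -> measurable_fun setT V ->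
  (\int[nu]_(y in Ycal) ((\int[Q]_u (V u * (expR (half_llr psi t0 x y u) *
      expR (m / 8 * (trunc b (dotp u x) - dotp t0 x) ^+ 2)))%:E) *
      (glm_density psi h x t0 y)%:E) <= \int[Q]_u (V u)%:E)%E.
Proof.
move=> tb V0 mV.
set w := dotp t0 x in tb *.
pose e u := expR (m / 8 * (trunc b (dotp u x) - w) ^+ 2).
pose r y u := expR (half_llr psi t0 x y u).
pose hD y := h y * \1_Ycal y.
pose p y := expR (w * y - psi w) * hD y.
have hD0 y : 0 <= hD y.
  rewrite /hD indicE; have [yD|_] := boolP (y \in Ycal); last by rewrite mulr0.
  by rewrite mulr1; apply: h_ge0; rewrite inE in yD.
have p0 y : 0 <= p y by rewrite mulr_ge0 ?expR_ge0.
have mexp z : measurable_fun setT (fun y : R => expR (z * y - psi z)).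
  by apply: measurableT_comp => //; apply: measurable_funB => //; exact: measurable_funM.
have mhD : measurable_fun setT hD := measurable_base_density.
have mp : measurable_fun setT p by exact: measurable_funM.
have mx dT (T : measurableType dT) : measurable_fun setT (fun _ : T => x).
  exact: measurable_cst.
have me : measurable_fun setT e.
  apply: measurableT_comp => //; apply: measurable_funM => //; apply: measurable_funX.
  apply: measurable_funB => //; apply: measurable_maxr => //; apply: measurable_minr => //.
  exact: measurable_dotp.
have mr : measurable_fun setT (fun q : R * d.-tuple R => r q.1 q.2).
  by apply: measurableT_comp => //; exact: measurable_half_llr.
have [nuD nuDI] := restricted_measure_ex mYcal nu_sigma_finite.
pose f (q : R * d.-tuple R) := V q.2 * (r q.1 q.2 * e q.2) * p q.1.
have e0 u : 0 <= e u by exact: expR_ge0.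
have r0 y u : 0 <= r y u by exact: expR_ge0.
have Vre0 y u : 0 <= V u * (r y u * e u).
  by apply: mulr_ge0 => //; apply: mulr_ge0.
have f0 q : 0 <= f q by apply: mulr_ge0.
have mf : measurable_fun setT (fun q => (f q)%:E).
  apply/measurable_EFinP; apply: measurable_funM; last exact: measurableT_comp.
  apply: measurable_funM; first exact: measurableT_comp.
  by apply: measurable_funM => //; exact: measurableT_comp.
have mVre y : measurable_fun setT (fun u => V u * (r y u * e u)).
  apply: measurable_funM => //; apply: measurable_funM => //.
  apply: measurableT_comp => //; apply: measurable_half_llr => //.
rewrite [leLHS](_ : _ = \int[nuD]_y \int[Q]_u (f (y, u))%:E)%E; last first.
  rewrite nuDI; last 2 first.
  - by move=> y; apply: integral_ge0 => u _; rewrite lee_fin.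
  - by apply: (measurable_fun_fubini_tonelli_F (m2 := Q) (fun q => (f q)%:E)).
  apply: eq_integral => y yD; rewrite /f/=.
  under [RHS]eq_integral do rewrite EFinM.
  rewrite ge0_integralZr//; last 3 first.
  - exact/measurable_EFinP.
  - by move=> u _; rewrite lee_fin.
  - by rewrite lee_fin.
  by rewrite /p /hD indicE yD mulr1.
rewrite (fubini_tonelli (m1 := nuD) (m2 := Q) (fun q => (f q)%:E))//.
apply: ge0_le_integral => //.
- by move=> u _; apply: integral_ge0 => y _; rewrite lee_fin.
- by apply: (measurable_fun_fubini_tonelli_G (m1 := nuD) (fun q => (f q)%:E)).
- by apply/measurable_EFinP.
move=> u _; set z := dotp u x; pose q := (z + w) / 2.
pose C := V u * e u * expR (psi q - 2^-1 * psi z - 2^-1 * psi w).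
have C0 : 0 <= C by apply: mulr_ge0; [exact: mulr_ge0|exact: expR_ge0].
(* The square root of the likelihood ratio times the density at [w] is a constant times the density
   at the midpoint [q], which integrates to 1. *)
have fE y : f (y, u) = C * (expR (q * y - psi q) * hD y).
  have rE : r y u * expR (w * y - psi w) =
      expR (psi q - 2^-1 * psi z - 2^-1 * psi w) * expR (q * y - psi q).
    by rewrite /r /half_llr -/w -/z -!expRD; congr expR; rewrite /q; field.
  rewrite /f /C /p/=; transitivity (V u * e u * (r y u * expR (w * y - psi w)) * hD y).
    by move: (hD y) (r y u) (e u) (expR _) => ? ? ? ?; ring.
  by rewrite rE; move: (hD y) (e u) (expR (q * y - psi q)) (expR _) => ? ? ? ?; ring.
under eq_integral do rewrite fE EFinM.
rewrite ge0_integralZl_EFin//; last 2 first.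
- by move=> y _; rewrite lee_fin mulr_ge0 ?expR_ge0.
- by apply/measurable_EFinP; exact: measurable_funM.
rewrite nuDI; last 2 first.
- by move=> y; rewrite lee_fin mulr_ge0 ?expR_ge0.
- by apply/measurable_EFinP; exact: measurable_funM.
have [_ _ p1] := exp_family_density q.
rewrite [X in (_ * X)%E](_ : _ = 1%E); last first.
  rewrite -[RHS]p1; apply: eq_integral => y yD.
  by rewrite /hD indicE yD mulr1.
rewrite mule1 lee_fin /C -mulrA ler_piMr// /e -expRD -[leRHS]expR0 ler_expR.
by have := bhattacharyya_gap z tb; rewrite -/q; lra.
Qed.

End one_step.

(** * The mixture and its forecasts *)

Section mixture.
Context {R : realType} {d : nat}.
Variables (psi : R -> R) (t0 : d.-tuple R) (b m : R).
Variable Q : {sigma_finite_measure set (d.-tuple R) -> \bar R}.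
Implicit Types (xs : nat -> d.-tuple R) (ys : nat -> R).
Hypothesis mpsi : measurable_fun setT psi.
Hypotheses (b_gt0 : 0 < b) (m_gt0 : 0 < m).
Hypothesis Q1 : Q setT = 1%E.

Local Notation lik := (sqrt_lik psi t0).

Hypothesis lik_lty : forall xs ys n, (\int[Q]_u (lik xs ys n u)%:E < +oo)%E.

Definition evidence xs ys n : R := fine (\int[Q]_u (lik xs ys n u)%:E).

Definition shifted_moment xs ys n : R :=
  fine (\int[Q]_u ((trunc b (dotp u (xs n)) + b) * lik xs ys n u)%:E).

(* The truncated prediction is shifted by b to keep the integrand nonnegative. *)
Definition forecast xs ys n : R := shifted_moment xs ys n / evidence xs ys n - b.

(** The [k]-th forecast already uses the [k]-th label, as its weights are those of q_(k+1). *)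
Definition sq_err xs ys n : R :=
  \sum_(1 <= k < n.+1) (dotp t0 (xs k) - forecast xs ys k) ^+ 2.

Definition wealth xs ys n : R :=
  evidence xs ys n * expR (m / 8 * sq_err xs ys n).

Lemma measurable_lik xs ys n : measurable_fun setT (lik xs ys n).
Proof.
by apply: measurable_sqrt_lik => //; move=> k _; exact: measurable_cst.
Qed.

Lemma evidenceE xs ys n : (evidence xs ys n)%:E = (\int[Q]_u (lik xs ys n u)%:E)%E.
Proof.
rewrite fineK// ge0_fin_numE ?lik_lty// integral_ge0// => u _.
by rewrite lee_fin expR_ge0.
Qed.

Lemma evidence_gt0 xs ys n : 0 < evidence xs ys n.
Proof.
rewrite -lte_fin evidenceE; apply: integral_gt0_probability => //.
  by move=> u; exact: sqrt_lik_gt0.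
exact: measurable_lik.
Qed.

Lemma evidence0 xs ys : evidence xs ys 0 = 1.
Proof.
apply: EFin_inj; rewrite evidenceE.
under eq_integral do rewrite /sqrt_lik big_geq// expR0.
by rewrite integral_cst// mul1e; exact: Q1.
Qed.

Lemma trunc_shift_ge0 z : 0 <= trunc b z + b.
Proof. by have := trunc_norm_le z b_gt0; rewrite ler_norml => /andP[]; lra. Qed.

Lemma trunc_shift_le z : trunc b z + b <= 2 * b.
Proof. by have := trunc_norm_le z b_gt0; rewrite ler_norml => /andP[]; lra. Qed.

Lemma measurable_trunc_dotp dT (T : measurableType dT) (f g : T -> d.-tuple R) :
  measurable_fun setT f -> measurable_fun setT g ->
  measurable_fun setT (fun p => trunc b (dotp (f p) (g p))).
Proof.
move=> mf mg; apply: measurable_maxr => //; apply: measurable_minr => //.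
exact: measurable_dotp.
Qed.

Lemma shifted_momentE xs ys n : (shifted_moment xs ys n)%:E =
  (\int[Q]_u ((trunc b (dotp u (xs n)) + b) * lik xs ys n u)%:E)%E.
Proof.
have J0 u : 0 <= (trunc b (dotp u (xs n)) + b) * lik xs ys n u.
  by rewrite mulr_ge0 ?trunc_shift_ge0// ltW// sqrt_lik_gt0.
have mt : measurable_fun setT (fun u => trunc b (dotp u (xs n)) + b).
  by apply: measurable_funD => //; apply: measurable_trunc_dotp => //; exact: measurable_cst.
have ml := measurable_lik xs ys n.
rewrite fineK// ge0_fin_numE; last by apply: integral_ge0 => u _; rewrite lee_fin.
apply: (@le_lt_trans _ _ (\int[Q]_u ((2 * b)%:E * (lik xs ys n u)%:E))%E).
  apply: ge0_le_integral => //.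
  - by move=> u _; rewrite lee_fin.
  - by apply/measurable_EFinP; exact: measurable_funM.
  - by apply: emeasurable_funM => //; exact/measurable_EFinP.
  - move=> u _; rewrite -EFinM lee_fin ler_wpM2r ?trunc_shift_le//.
    exact/ltW/sqrt_lik_gt0.
rewrite ge0_integralZl_EFin//; last 3 first.
- by move=> u _; rewrite lee_fin ltW// sqrt_lik_gt0.
- exact/measurable_EFinP.
- by rewrite mulr_ge0// ltW.
by rewrite -evidenceE -EFinM ltry.
Qed.

Section measurable_families.
Context dT (T : measurableType dT).
Variables (xs : T -> nat -> d.-tuple R) (ys : T -> nat -> R) (n : nat).
Hypothesis mx : forall k, (1 <= k <= n)%N -> measurable_fun setT (xs ^~ k).
Hypothesis my : forall k, (1 <= k <= n)%N -> measurable_fun setT (ys ^~ k).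

Lemma measurable_lik_pair :
  measurable_fun setT (fun q : T * d.-tuple R => lik (xs q.1) (ys q.1) n q.2).
Proof.
apply: measurable_sqrt_lik => // k kn.
  exact: (measurableT_comp (mx kn)).
exact: (measurableT_comp (my kn)).
Qed.

Lemma measurable_evidence : measurable_fun setT (fun p => evidence (xs p) (ys p) n).
Proof.
apply/measurable_EFinP; rewrite [X in measurable_fun _ X](_ : _ =
    fun p => (\int[Q]_u (lik (xs p) (ys p) n u)%:E)%E); last first.
  by apply/funext => p /=; rewrite evidenceE.
apply: (measurable_fun_fubini_tonelli_F (m2 := Q)
  (fun q : T * d.-tuple R => (lik (xs q.1) (ys q.1) n q.2)%:E)).
  by apply/measurable_EFinP; exact: measurable_lik_pair.
by move=> q; rewrite lee_fin ltW// sqrt_lik_gt0.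
Qed.

Lemma measurable_forecast : (1 <= n)%N ->
  measurable_fun setT (fun p => forecast (xs p) (ys p) n).
Proof.
move=> n1; apply: measurable_funB => //; apply: measurable_funM; last first.
  (* On positive reals the inverse is [expR (- ln x)], a composition of measurable functions. *)
  rewrite (_ : (fun p => _) = fun p => expR (- ln (evidence (xs p) (ys p) n))).
    by do 3 apply: measurableT_comp => //; exact: measurable_evidence.
  by apply/funext => p; rewrite expRN lnK// posrE evidence_gt0.
apply/measurable_EFinP; rewrite [X in measurable_fun _ X](_ : _ =
    fun p => (\int[Q]_u ((trunc b (dotp u (xs p n)) + b) * lik (xs p) (ys p) n u)%:E)%E);
  last by apply/funext => p /=; rewrite shifted_momentE.
apply: (measurable_fun_fubini_tonelli_F (m2 := Q)
  (fun q : T * d.-tuple R =>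
    ((trunc b (dotp q.2 (xs q.1 n)) + b) * lik (xs q.1) (ys q.1) n q.2)%:E)).
  apply/measurable_EFinP; apply: measurable_funM; last exact: measurable_lik_pair.
  apply: measurable_funD => //; apply: measurable_trunc_dotp => //.
  by apply: (measurableT_comp (mx _)); rewrite ?n1 ?leqnn.
by move=> q; rewrite lee_fin mulr_ge0 ?trunc_shift_ge0// ltW// sqrt_lik_gt0.
Qed.

End measurable_families.

Lemma measurable_sq_err dT (T : measurableType dT)
    (xs : T -> nat -> d.-tuple R) (ys : T -> nat -> R) n :
  (forall k, (1 <= k <= n)%N -> measurable_fun setT (xs ^~ k)) ->
  (forall k, (1 <= k <= n)%N -> measurable_fun setT (ys ^~ k)) ->
  measurable_fun setT (fun p => sq_err (xs p) (ys p) n).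
Proof.
elim: n => [|n IH] mx my.
  by under eq_fun do rewrite /sq_err big_geq//; exact: measurable_cst.
under eq_fun do rewrite /sq_err big_nat_recr//=.
apply: measurable_funD.
  by apply: IH => k /andP[k1 kn]; [apply: mx|apply: my]; rewrite k1 leqW.
apply: measurable_funX; apply: measurable_funB; last exact: measurable_forecast.
apply: measurable_dotp; first exact: measurable_cst.
by apply: mx; rewrite leqnn.
Qed.

Lemma measurable_wealth dT (T : measurableType dT)
    (xs : T -> nat -> d.-tuple R) (ys : T -> nat -> R) n :
  (forall k, (1 <= k <= n)%N -> measurable_fun setT (xs ^~ k)) ->
  (forall k, (1 <= k <= n)%N -> measurable_fun setT (ys ^~ k)) ->
  measurable_fun setT (fun p => wealth (xs p) (ys p) n).
Proof.
move=> mx my; apply: measurable_funM; first exact: measurable_evidence.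
by apply: measurableT_comp => //; apply: measurable_funM => //; exact: measurable_sq_err.
Qed.

Lemma wealth_ge0 xs ys n : 0 <= wealth xs ys n.
Proof. by rewrite mulr_ge0 ?expR_ge0// ltW// evidence_gt0. Qed.

Lemma wealth0 xs ys : wealth xs ys 0 = 1.
Proof. by rewrite /wealth /sq_err big_geq// mulr0 expR0 mulr1 evidence0. Qed.

(** A majorant of the next wealth with the new observation as separate arguments. The new forecast,
    which depends on [y] through a quotient, no longer occurs, so [y] can be integrated out. *)
Definition step_bound xs ys n (x : d.-tuple R) (y : R) : \bar R :=
  ((expR (m / 8 * sq_err xs ys n))%:E *
   \int[Q]_u (lik xs ys n u * (expR (half_llr psi t0 x y u) *
      expR (m / 8 * (trunc b (dotp u x) - dotp t0 x) ^+ 2)))%:E)%E.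

(** Jensen's inequality with weights [lik xs ys n.+1]: the weighted mean of the truncated
    predictions is the new forecast. *)
Lemma wealthS_le xs ys n :
  ((wealth xs ys n.+1)%:E <= step_bound xs ys n (xs n.+1) (ys n.+1))%E.
Proof.
rewrite /wealth /sq_err big_nat_recr//= mulrDr expRD mulrCA EFinM.
apply: lee_wpmul2l; first by rewrite lee_fin expR_ge0.
under eq_integral do rewrite mulrA -sqrt_likS.
apply: jensen_exp_sqr (esym (evidenceE _ _ _)) (esym (shifted_momentE _ _ _)).
- by move=> u; exact/ltW/sqrt_lik_gt0.
- exact: measurable_lik.
- by apply: measurable_trunc_dotp => //; exact: measurable_cst.
- by move=> u; exact: trunc_norm_le.
- by rewrite divr_ge0// ltW.
- exact: evidence_gt0.
Qed.

End mixture.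

(** * The forecaster of the statement *)

Section ewa_forecast.
Context {R : realType} {d : nat}.
Variables (psi h : R -> R) (t0 : d.-tuple R) (b : R).
Variable Q : {sigma_finite_measure set (d.-tuple R) -> \bar R}.
Hypothesis mpsi : measurable_fun setT psi.
Hypothesis b_gt0 : 0 < b.
Hypothesis Q1 : Q setT = 1%E.
Hypothesis lik_lty : forall xs ys n, (\int[Q]_u (sqrt_lik psi t0 xs ys n u)%:E < +oo)%E.

(** The exponential weight and [sqrt_lik] differ by a factor [K] independent of the parameter, which
    cancels in the normalisation. *)
Lemma ewa_forecast (xs : nat -> d.-tuple R) (ys : nat -> R) n :
  fine (\int[ewa 2^-1 Q (fun k => glm_loss psi h (xs k) (ys k)) n.+1]_u
    (trunc b (dotp u (xs n)))%:E)%E = forecast psi t0 b Q xs ys n.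
Proof.
set I := evidence psi t0 Q xs ys n; set J := shifted_moment psi t0 b Q xs ys n.
have IE : (\int[Q]_u (sqrt_lik psi t0 xs ys n u)%:E)%E = I%:E by rewrite /I evidenceE.
have JE : (\int[Q]_u ((trunc b (dotp u (xs n)) + b) * sqrt_lik psi t0 xs ys n u)%:E)%E = J%:E.
  by rewrite /J shifted_momentE.
have I0 : 0 < I by exact: evidence_gt0.
(* [K] collects the terms at [t0] and those in [ln (h (ys k))]; being an exponential it is positive
   whatever the value of [h]. *)
pose K := expR (\sum_(1 <= k < n.+1)
  2^-1 * (dotp t0 (xs k) * ys k - psi (dotp t0 (xs k)) + ln (h (ys k)))).
have K0 : 0 < K by exact: expR_gt0.
have fE u : expR (- 2^-1 * \sum_(1 <= k < n.+1) glm_loss psi h (xs k) (ys k) u) =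
    K * sqrt_lik psi t0 xs ys n u.
  rewrite /K /sqrt_lik -expRD; congr expR; rewrite mulr_sumr -big_split/=.
  by apply: eq_bigr => k _; rewrite /glm_loss /half_llr; field.
have ml := measurable_lik t0 mpsi xs ys n.
rewrite /ewa; under [X in normalized_density _ X]eq_fun do rewrite fE.
have L0 u : 0 <= K * sqrt_lik psi t0 xs ys n u.
  by rewrite mulr_ge0 ?ltW// sqrt_lik_gt0.
have mKl : measurable_fun setT (fun u => K * sqrt_lik psi t0 xs ys n u).
  exact: measurable_funM.
have KI : (\int[Q]_u (K * sqrt_lik psi t0 xs ys n u)%:E)%E = (K * I)%:E.
  under eq_integral do rewrite EFinM.
  rewrite ge0_integralZl_EFin ?(ltW K0)//; first by rewrite IE.
  - by move=> u _; rewrite lee_fin ltW// sqrt_lik_gt0.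
  - exact/measurable_EFinP.
have KI0 : 0 < K * I by rewrite mulr_gt0.
have [N [NE NI]] := normalized_density_ex L0 mKl KI0 KI.
have mt : measurable_fun setT (fun u : d.-tuple R => trunc b (dotp u (xs n))).
  by apply: measurable_trunc_dotp => //; exact: measurable_cst.
have t_ge0 u : 0 <= trunc b (dotp u (xs n)) + b by exact: trunc_shift_ge0.
have mtb : measurable_fun setT (fun u : d.-tuple R => trunc b (dotp u (xs n)) + b).
  exact: measurable_funD.
have N1 : (\int[N]_u (1 : R)%:E = 1%:E)%E.
  rewrite NI//; under eq_integral do rewrite mul1e.
  by rewrite KI -EFinM mulVf// gt_eqF.
have Ntb : (\int[N]_u (trunc b (dotp u (xs n)) + b)%:E = (J / I)%:E)%E.
  rewrite NI//; last exact/measurable_EFinP.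
  under eq_integral do rewrite -EFinM mulrCA EFinM.
  rewrite ge0_integralZl_EFin ?(ltW K0)//; last 2 first.
  - by move=> u _; rewrite lee_fin mulr_ge0// ltW// sqrt_lik_gt0.
  - by apply/measurable_EFinP; exact: measurable_funM.
  by rewrite JE -!EFinM; congr (_%:E); field; rewrite !gt_eqF.
have int (f : d.-tuple R -> R) (k : R) : (forall u, 0 <= f u) -> measurable_fun setT f ->
    (\int[N]_u (f u)%:E = k%:E)%E -> N.-integrable setT (EFin \o f).
  move=> f_ge0 mf fK; apply/integrableP; split; first exact/measurable_EFinP.
  under eq_integral do rewrite /= ger0_norm//.
  by rewrite fK ltry.
have Nb : (\int[N]_u b%:E = b%:E)%E.
  by move: N1; rewrite !integral_cst// mul1e => ->; rewrite mule1.
have i1 : N.-integrable setT (EFin \o (fun=> b)).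
  by apply: (int _ b) => // _; exact: ltW.
have i2 := int _ _ t_ge0 mtb Ntb.
rewrite -NE (_ : \int[N]_u _ = (J / I - b)%:E)%E//.
under eq_integral => u _.
  rewrite (_ : trunc b _ = (trunc b (dotp u (xs n)) + b) - b) ?EFinB; last by rewrite addrK.
  over.
by rewrite integralB_EFin// Ntb Nb EFinB.
Qed.

End ewa_forecast.

(** * Lower bound on the prior weight of a subset *)

Section weights.
Context {R : realType}.

Lemma exprn_le_fact_expR (x : R) n : 0 <= x -> x ^+ n <= n`!%:R * expR x.
Proof.
move=> x0; case: n => [|n]; first by rewrite expr0 fact0 mul1r -[leLHS]expR0 ler_expR.
have := expR_ge1Dxn n x0 => H.
rewrite mulrC -ler_pdivrMr ?ltr0n ?fact_gt0//.
by apply: le_trans H; rewrite lerDr.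
Qed.

(** From ['C(d, s) <= d ^ s / s!] and [s ^ s <= s! * e ^ s], the latter being one term of the
    exponential series at [s]. *)
Lemma bin_le d s : (1 <= s <= d)%N ->
  'C(d, s)%:R <= (expR 1 * d%:R / s%:R) ^+ s :> R.
Proof.
move=> /andP[s1 sd].
have s0 : 0 < s%:R :> R by rewrite ltr0n.
have f0 : 0 < s`!%:R :> R by rewrite ltr0n fact_gt0.
have h1 : 'C(d, s)%:R * s`!%:R <= d%:R ^+ s :> R.
  rewrite -natrM bin_ffact -natrX ler_nat.
  elim: (s) => [|k IH]; first by rewrite ffactn0.
  by rewrite ffactnSr expnSr leq_mul// leq_subr.
have h2 : s%:R ^+ s <= s`!%:R * expR 1 ^+ s :> R.
  by rewrite -expRM_natl mulr1; exact: exprn_le_fact_expR.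
rewrite -(ler_pM2r f0); apply: (le_trans h1).
rewrite expr_div_n exprMn.
have -> : expR 1 ^+ s * d%:R ^+ s / s%:R ^+ s * s`!%:R =
    d%:R ^+ s * (s`!%:R * expR 1 ^+ s) / s%:R ^+ s :> R.
  by move: (expR 1 ^+ s) (s%:R ^+ s)^-1 => x y; ring.
by rewrite ler_pdivlMr ?exprn_gt0// ler_wpM2l// exprn_ge0.
Qed.

Lemma geometric_half_le n : \sum_(0 <= k < n) 2 ^- k <= 2 :> R.
Proof.
suff -> : \sum_(0 <= k < n) 2 ^- k = 2 - 2 * 2 ^- n :> R.
  by rewrite gerBl mulr_ge0// invr_ge0 exprn_ge0.
elim: n => [|n IH]; first by rewrite big_geq// expr0 invr1 mulr1 subrr.
by rewrite big_nat_recr//= IH exprS invfM; field; rewrite expf_neq0.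
Qed.

(** The binomial coefficient is bounded by [bin_le] and the geometric normaliser by 2. This is the
    source of the logarithm of [2 * e * d / s] in [beta]. *)
Lemma subset_weight_ge d (S : {set 'I_d}) : (1 <= #|S|)%N ->
  1 <= subset_weight S * (2 * (2 * expR 1 * d%:R / #|S|%:R) ^+ #|S|) :> R.
Proof.
move=> S1; set s := #|S| in S1 *.
have sd : (s <= d)%N by rewrite -[leqRHS]card_ord max_card.
pose K : R := \sum_(0 <= k < d.+1) 2 ^- k.
have K0 : 0 < K.
  rewrite /K big_nat_recl// ltr_wpDr// ?expr0 ?invr1//.
  by apply: sumr_ge0 => i _; rewrite invr_ge0 exprn_ge0.
have C0 : 0 < 'C(d, s)%:R :> R by rewrite ltr0n bin_gt0.
rewrite /subset_weight -/s -/K.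
have -> : 2 ^- s / ('C(d, s)%:R * K) * (2 * (2 * expR 1 * d%:R / s%:R) ^+ s) =
    (expR 1 * d%:R / s%:R) ^+ s / 'C(d, s)%:R * (2 / K) :> R.
  rewrite (_ : 2 * expR 1 * d%:R / s%:R = 2 * (expR 1 * d%:R / s%:R)); last by rewrite !mulrA.
  by rewrite exprMn; field; rewrite !gt_eqF//= expf_neq0.
rewrite -[leLHS]mulr1; apply: ler_pM => //.
- by rewrite ler_pdivlMr// mul1r; apply: bin_le; rewrite S1.
- by rewrite ler_pdivlMr// mul1r; exact: geometric_half_le.
Qed.

End weights.

(** * The confidence sequence *)

Section supermartingale.
Context {R : realType} {d : nat}.
Variables (psi h : R -> R) (t0 : d.-tuple R) (nu : {measure set R -> \bar R}).
Variables (Ycal : set R) (b m M c : R).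
Hypotheses (d_gt0 : (1 <= d)%N) (mYcal : measurable Ycal).
Hypotheses (nu_sigma_finite : sigma_finite Ycal nu).
Hypotheses (h_ge0 : forall y, Ycal y -> 0 <= h y).
Hypothesis psi_cvx : convex_function [set: R^o] (psi : R^o -> R^o).
Hypothesis mpsi : measurable_fun setT psi.
Hypothesis glm_densityP : forall x theta : d.-tuple R,
    probability_density nu Ycal (glm_density psi h x theta).
Hypotheses (b_gt0 : 0 < b) (m_gt0 : 0 < m) (psi_smooth : smooth M psi).
Hypothesis psi_sc : strongly_convex_on `[- b, b] m psi.
Variable Q : {sigma_finite_measure set (d.-tuple R) -> \bar R}.
Hypothesis Q1 : Q setT = 1%E.
Hypothesis lik_lty : forall xs ys n, (\int[Q]_u (sqrt_lik psi t0 xs ys n u)%:E < +oo)%E.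
Context {dO : measure_display} {Omega : measurableType dO}.
Variables (P : probability Omega R).
Variables (X : nat -> {RV P >-> d.-tuple R}) (Y : nat -> {RV P >-> R}).
Hypothesis Y_density : forall t, (1 <= t)%N ->
    conditional_density (history X Y t.-1) nu Ycal (Y t)
      (fun w => glm_density psi h (X t w) t0).
Hypothesis tX_bounded :
    {ae P, forall w t, (1 <= t)%N -> `|dotp t0 (X t w)| <= b}.

Local Notation xs w := (fun k => X k w).
Local Notation ys w := (fun k => Y k w).
Local Notation N n w := (wealth psi t0 b m Q (xs w) (ys w) n).

Lemma measurable_X k : measurable_fun setT (fun w => X k w).
Proof. exact: measurable_funP. Qed.

Lemma measurable_Y k : measurable_fun setT (fun w => Y k w).
Proof. exact: measurable_funP. Qed.

Lemma measurable_wealth_RV n : measurable_fun setT (fun w => N n w).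
Proof.
by apply: measurable_wealth.
Qed.

(** On the past event [A] the next wealth is majorised by [step_bound], the label is integrated out
    against its conditional density, and [one_step] returns the current wealth. *)
Lemma wealth_supermartingale n :
  let A := [set w | forall k, (k < n.+1)%N -> N k w < c] in
  (\int[P]_(w in A) (N n.+1 w)%:E <= \int[P]_(w in A) (N n w)%:E)%E.
Proof.
set A := [set w | _]; cbv zeta.
(* The generators of [history X Y n]: covariates up to [n.+1], labels up to [n] only. *)
pose G := [set A | (exists k B, [/\ (1 <= k <= n.+1)%N, measurable B &
                                A = X k @^-1` B]) \/
               (exists k C, [/\ (1 <= k <= n)%N, measurable C &
                                A = Y k @^-1` C])].
pose T := g_sigma_algebraType G.
have mG : G `<=` measurable.
  move=> _ [[k [B [_ mB ->]]]|[k [B [_ mB ->]]]].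
    by rewrite -[X in measurable X]setTI; exact: measurable_X.
  by rewrite -[X in measurable X]setTI; exact: measurable_Y.
have mX k : (1 <= k <= n.+1)%N -> measurable_fun setT (fun w : T => X k w).
  move=> kn _ B mB; rewrite setTI; apply: sub_sigma_algebra.
  by left; exists k, B.
have mY k : (1 <= k <= n)%N -> measurable_fun setT (fun w : T => Y k w).
  move=> kn _ B mB; rewrite setTI; apply: sub_sigma_algebra.
  by right; exists k, B.
have mXn k : (1 <= k <= n)%N -> measurable_fun setT (fun w : T => X k w).
  by move=> /andP[k1 kn]; apply: mX; rewrite k1 leqW.
(* The wealth at a time [k <= n] depends on the first [k] pairs only, so [A] belongs to the past. *)
have mAT : measurable (A : set T).
  rewrite (_ : A = \bigcap_(k in `I_n.+1) ((fun w : T => N k w) @^-1` `]-oo, c[%classic)).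
    apply: bigcap_measurable => [|k /= kn]; first by exists 0%N.
    rewrite -[X in measurable X]setTI; apply: measurable_wealth => //.
      by move=> j /andP[j1 jk]; apply: mXn; rewrite j1 (leq_trans jk).
    by move=> j /andP[j1 jk]; apply: mY; rewrite j1 (leq_trans jk).
  by apply/seteqP; split => w /= Aw k kn; have := Aw k kn; rewrite /= in_itv.
have mA : measurable A by exact: (sub_history mG mAT).
pose x w := X n.+1 w.
(* The label [Y n.+1] is replaced by a free second variable; all else, [X n.+1] included, is
   measurable with respect to the past. *)
pose g (p : T * R) : \bar R :=
  ((\1_A p.1)%:E * step_bound psi t0 b m Q (xs p.1) (ys p.1) n (x p.1) p.2)%E.
have g0 p : (0 <= g p)%E.
  apply: mule_ge0; first by rewrite lee_fin.
  apply: mule_ge0; first by rewrite lee_fin expR_ge0.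
  by apply: integral_ge0 => u _; rewrite lee_fin !mulr_ge0 ?expR_ge0.
have mx1 : measurable_fun setT (fun p : T * R => x p.1).
  have n1 : (1 <= n.+1 <= n.+1)%N by rewrite /= leqnn.
  exact: (measurableT_comp (mX n.+1 n1) measurable_fst).
have mg : measurable_fun setT g.
  apply: emeasurable_funM.
    apply/measurable_EFinP; apply: (measurableT_comp (f := \1_A : T -> R)) => //.
  apply: emeasurable_funM.
    apply/measurable_EFinP; apply: measurableT_comp => //; apply: measurable_funM => //.
    apply: (@measurable_sq_err _ _ _ _ _ _ mpsi b_gt0 Q1 lik_lty _ _
      (fun p : T * R => xs p.1) (fun p => ys p.1)) => k kn.
      exact: (measurableT_comp (mXn k kn)).
    exact: (measurableT_comp (mY k kn)).
  pose F := fun q : (T * R) * d.-tuple R =>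
    (sqrt_lik psi t0 (xs q.1.1) (ys q.1.1) n q.2 *
      (expR (half_llr psi t0 (x q.1.1) q.1.2 q.2) *
       expR (m / 8 * (trunc b (dotp q.2 (x q.1.1)) - dotp t0 (x q.1.1)) ^+ 2)))%:E.
  apply: (measurable_fun_fubini_tonelli_F (m2 := Q) F); last first.
    by move=> q; rewrite lee_fin !mulr_ge0 ?expR_ge0.
  have mxq : measurable_fun setT (fun q : (T * R) * d.-tuple R => x q.1.1).
    exact: (measurableT_comp mx1).
  apply/measurable_EFinP; apply: measurable_funM.
    apply: measurable_sqrt_lik => // k kn.
      apply: (measurableT_comp (mXn k kn)); exact: measurableT_comp.
    apply: (measurableT_comp (mY k kn)); exact: measurableT_comp.
  apply: measurable_funM; apply: measurableT_comp => //.
    apply: measurable_half_llr => //; exact: measurableT_comp.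
  apply: measurable_funM => //; apply: measurable_funX; apply: measurable_funB.
    exact: measurable_trunc_dotp.
  by apply: measurable_dotp => //; exact: measurable_cst.
pose f w := glm_density psi h (x w) t0.
have f0 w y : Ycal y -> 0 <= f w y.
  by move=> Yy; rewrite mulr_ge0 ?expR_ge0// h_ge0.
have mf : measurable_fun setT (fun p : T * R => f p.1 p.2 * \1_Ycal p.2).
  rewrite (_ : (fun p => _) = fun p : T * R =>
    expR (dotp t0 (x p.1) * p.2 - psi (dotp t0 (x p.1))) * (h p.2 * \1_Ycal p.2)); last first.
    by apply/funext => p; rewrite /f /glm_density mulrA.
  have mdt : measurable_fun setT (fun p : T * R => dotp t0 (x p.1)).
    by apply: measurable_dotp => //; exact: measurable_cst.
  apply: measurable_funM.
    apply: measurableT_comp => //; apply: measurable_funB; last exact: measurableT_comp.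
    exact: measurable_funM.
  apply: (measurableT_comp (f := fun y => h y * \1_Ycal y)) => //.
  exact: (measurable_base_density d_gt0 mYcal glm_densityP).
have N0 k w : (0 <= (N k w)%:E)%E by rewrite lee_fin; exact: wealth_ge0.
have mN k : measurable_fun setT (fun w => (N k w)%:E).
  by apply/measurable_EFinP; exact: measurable_wealth_RV.
rewrite (integral_indicM P A) [leRHS](integral_indicM P A).
apply: (@le_trans _ _ (\int[P]_w g (w, Y n.+1 w))%E).
  apply: ge0_le_integral.
  - exact: measurableT.
  - by move=> w _; apply: mule_ge0; [exact: N0|by rewrite lee_fin].
  - by apply: emeasurable_funM => //; apply/measurable_EFinP; exact: measurable_indic.
  - exact: (measurable_fun_pair_RV mG _ mg).
  - move=> w _; rewrite /g/= muleC; apply: lee_wpmul2l; first by rewrite lee_fin.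
    exact: (wealthS_le mpsi b_gt0 m_gt0 Q1 lik_lty (xs w) (ys w) n).
have cd : conditional_density <<s G >> nu Ycal (Y n.+1) f by exact: (Y_density (t := n.+1)).
rewrite (conditional_density_integral mG mYcal nu_sigma_finite cd f0 mf g0 mg).
apply: ae_ge0_le_integral.
- exact: measurableT.
- by move=> w _; apply: integral_ge0 => y Yy; rewrite mule_ge0// lee_fin f0.
- exact: (measurable_section_integral mG mYcal nu_sigma_finite f0 mf g0 mg).
- by move=> w _; apply: mule_ge0; [exact: N0|by rewrite lee_fin].
- by apply: emeasurable_funM => //; apply/measurable_EFinP; exact: measurable_indic.
apply: filterS tX_bounded => w /(_ n.+1 isT) tb _.
rewrite /g/= muleC indicE; case: (w \in A); last first.
  rewrite mul0e [leLHS](_ : _ = 0%E)//; apply: integral0_eq => y _.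
  by rewrite !mul0e.
rewrite (_ : true%:R = 1 :> R)//.
set S := expR (m / 8 * sq_err psi t0 b Q (xs w) (ys w) n).
(* The past error factor [S] is constant in [u], so the integral of [V] is the current wealth. *)
pose V u := S * sqrt_lik psi t0 (xs w) (ys w) n u.
have ml : measurable_fun setT (sqrt_lik psi t0 (xs w) (ys w) n) by exact: measurable_lik.
have l0 u : 0 <= sqrt_lik psi t0 (xs w) (ys w) n u by exact/ltW/sqrt_lik_gt0.
have V0 u : 0 <= V u by rewrite mulr_ge0 ?expR_ge0.
have mV : measurable_fun setT V by exact: measurable_funM.
have := one_step d_gt0 mYcal nu_sigma_finite h_ge0 psi_cvx mpsi glm_densityP
  b_gt0 psi_smooth psi_sc Q tb V0 mV.
rewrite [leRHS](_ : _ = 1 * (N n w)%:E)%E; last first.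
  rewrite mul1e /wealth (mulrC (evidence _ _ _ _ _ _)) EFinM evidenceE// -/S.
  rewrite -ge0_integralZl_EFin ?expR_ge0//; first by move=> u _; rewrite lee_fin.
  exact/measurable_EFinP.
apply: le_trans; rewrite le_eqVlt; apply/orP; left; apply/eqP.
apply: eq_integral => y _; rewrite mul1e; congr (_ * _)%E.
rewrite /step_bound -/S -ge0_integralZl_EFin ?expR_ge0//; last 2 first.
- by move=> u _; rewrite lee_fin !mulr_ge0 ?expR_ge0.
- apply/measurable_EFinP; apply: measurable_funM => //.
  apply: measurable_funM; apply: measurableT_comp => //.
    by apply: measurable_half_llr => //; exact: measurable_cst.
  apply: measurable_funM => //; apply: measurable_funX; apply: measurable_funB => //.
  by apply: measurable_trunc_dotp => //; exact: measurable_cst.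
by apply: eq_integral => u _; rewrite -EFinM; congr (_%:E); rewrite /V /x -!mulrA.
Qed.


End supermartingale.

(** Off a null set [E] is contained in [F]. It serves to use a bound on the covariates that holds
    almost surely. *)
Lemma ae_confidence {R : realType} {dO : measure_display} {Omega : measurableType dO}
    (P : probability Omega R) (A E F : set Omega) (dl : R) :
  measurable E -> measurable F -> {ae P, forall w, A w} ->
  (forall w, A w -> E w -> F w) -> (P F <= dl%:E)%E -> (P E <= dl%:E)%E.
Proof.
move=> mE mF [Z [mZ PZ AZ]] AEF; apply: le_trans.
rewrite -[leRHS]adde0 -PZ; apply: le_trans (measureU2 _ mF mZ).
apply: le_measure; rewrite ?inE//; first exact: measurableU.
move=> w Ew; have [Aw|nAw] := pselect (A w); first by left; exact: AEF.
by right; apply: AZ.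
Qed.

(** With [z = 2 * e * d / s], exponentiating gives [expR (m / 8 * sig) >= (z * r) ^+ s * 2 * sqrt e
    / delta]. These factors undo those of the evidence bound: [r ^- s], [expR (- 2^-1)], and a prior
    weight of at least [1 / (2 * z ^+ s)]. *)
Lemma half_sq_err_gt_beta {R : realType} (s d : nat) (m r delta sig I wt : R) :
  0 < m -> 0 < delta -> 0 < r -> (1 <= s)%N -> (0 < d)%N ->
  1 <= wt * (2 * (2 * expR 1 * d%:R / s%:R) ^+ s) -> 0 <= wt ->
  wt * (r ^- s * expR (- 2^-1)) <= I ->
  4 * s%:R / m * ln (2 * expR 1 * d%:R * r / s%:R) +
    4 / m * ln (2 * Num.sqrt (expR 1) / delta) < 2^-1 * sig ->
  delta^-1 <= I * expR (m / 8 * sig).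
Proof.
move=> m0 dl0 r0 s1 d0 wt1 wt0 wtI H.
have s0 : 0 < s%:R :> R by rewrite ltr0n.
have d0' : 0 < d%:R :> R by rewrite ltr0n.
have sq : Num.sqrt (expR 1) = expR (2^-1) :> R.
  rewrite (_ : expR 1 = expR (2^-1) ^+ 2); last by rewrite -expRM_natl; congr expR; field.
  by rewrite sqrtr_sqr ger0_norm// expR_ge0.
rewrite sq in H.
set z := 2 * expR 1 * d%:R / s%:R in wt1.
have z0 : 0 < z by rewrite !mulr_gt0 ?expR_gt0 ?invr_gt0.
have zr : 2 * expR 1 * d%:R * r / s%:R = z * r by rewrite /z mulrAC.
rewrite zr in H.
have e0 : 0 < 2 * expR 2^-1 / delta :> R by rewrite divr_gt0 ?mulr_gt0 ?expR_gt0.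
have H1 : s%:R * ln (z * r) + ln (2 * expR 2^-1 / delta) <= m / 8 * sig.
  (* Multiplying by [m / 4] clears the constants of [beta] and turns [2^-1 * sig] into the exponent
     [m / 8 * sig] of the wealth. *)
  have := ler_wpM2l (ltW (divr_gt0 m0 (ltr0n R 4 : 0 < 4))) (ltW H).
  have -> : m / 4 * (4 * s%:R / m * ln (z * r) + 4 / m * ln (2 * expR 2^-1 / delta)) =
    s%:R * ln (z * r) + ln (2 * expR 2^-1 / delta) by field; rewrite gt_eqF.
  by have -> : m / 4 * (2^-1 * sig) = m / 8 * sig by field.
have H2 : (z * r) ^+ s * (2 * expR 2^-1 / delta) <= expR (m / 8 * sig).
  apply: le_trans (_ : expR (s%:R * ln (z * r) + ln (2 * expR 2^-1 / delta)) <= _).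
    by rewrite expRD expRM_natl !lnK// posrE// mulr_gt0.
  by rewrite ler_expR.
apply: le_trans (_ : wt * (r ^- s * expR (- 2^-1)) *
  ((z * r) ^+ s * (2 * expR 2^-1 / delta)) <= _); last first.
  apply: ler_pM => //.
    by rewrite !mulr_ge0 ?expR_ge0// invr_ge0 exprn_ge0// ltW.
  by rewrite mulr_ge0 ?exprn_ge0 ?ltW// mulr_gt0.
rewrite expRN exprMn.
have -> : wt * (r ^- s / expR 2^-1) * (z ^+ s * r ^+ s * (2 * expR 2^-1 / delta)) =
    (wt * (2 * z ^+ s)) * delta^-1.
  by field; rewrite !gt_eqF ?expR_gt0 ?exprn_gt0.
by rewrite ler_peMl// invr_ge0 ltW.
Qed.

Theorem theorem4p7 (R : realType) (d : nat) (d_gt0 : (1 <= d)%N)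
  (Ycal : set R) (mYcal : measurable Ycal)
  (nu : {measure set R -> \bar R}) (nu_sigma_finite : sigma_finite Ycal nu)
  (h psi : R -> R)
  (h_ge0 : forall y, Ycal y -> 0 <= h y)
  (psi_convex : convex_function [set: R^o] (psi : R^o -> R^o))
  (psi_derivable : forall z, derivable psi z 1)
  (glm_densityP : forall x theta : d.-tuple R,
    probability_density nu Ycal (glm_density psi h x theta))
  (dO : measure_display) (Omega : measurableType dO)
  (P : probability Omega R)
  (X : nat -> {RV P >-> d.-tuple R}) (Y : nat -> {RV P >-> R})
  (Y_Ycal : forall t w, (1 <= t)%N -> Ycal (Y t w))
  (theta_star : d.-tuple R)
  (Y_density : forall t, (1 <= t)%N ->
    conditional_density (history X Y t.-1) nu Ycal (Y t)
      (fun w => glm_density psi h (X t w) theta_star))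
  (b B Loo M m : R)
  (b_gt0 : 0 < b) (B_gt0 : 0 < B) (Loo_gt0 : 0 < Loo)
  (M_gt0 : 0 < M) (m_gt0 : 0 < m)
  (s : nat) (s_range : (1 <= s <= d)%N)
  (psi_smooth : smooth M psi)
  (psi_strongly_convex : strongly_convex_on `[- b, b] m psi)
  (theta_star_sparse : sparse s theta_star)
  (theta_star_norm : norm2 theta_star <= B)
  (X_bounded : {ae P, forall w t, (1 <= t)%N -> norm_oo (X t w) <= Loo})
  (theta_star_X_bounded :
    {ae P, forall w t, (1 <= t)%N -> `|dotp theta_star (X t w)| <= b})
  (delta : R) (delta_range : 0 < delta < 1) :
  confidence_sequence P delta
    (conf_set X Y psi h s m M B b Loo delta) theta_star.
Proof.
case/andP: s_range => s1 sd; case/andP: delta_range => dl0 dl1.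
have mpsi : measurable_fun setT psi.
  apply: continuous_measurable_fun => z.
  exact/differentiable_continuous/derivable1_diffP.
have [Q [QE Q1 QI]] := subset_prior_ex d B_gt0.
have lik_lty xs ys n : (\int[Q]_u (sqrt_lik psi theta_star xs ys n u)%:E < +oo)%E.
  rewrite QI; last 2 first.
  - by move=> u; rewrite lee_fin ltW// sqrt_lik_gt0.
  - by apply/measurable_EFinP; exact: measurable_lik.
  exact: prior_sqrt_lik_lty.
pose xs w := fun k => X k w; pose ys w := fun k => Y k w.
pose N n w := wealth psi theta_star b m Q (xs w) (ys w) n.
have fE t w : Yhat X Y psi h B b t w = forecast psi theta_star b Q (xs w) (ys w) t.
  by rewrite /Yhat /glm_ewa -QE; exact: ewa_forecast.
have mN n : measurable_fun setT (N n) by exact: measurable_wealth_RV.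
have mlt n (u : R) : measurable [set w | (u <= N n w)].
  rewrite (_ : [set w | _] = N n @^-1` `[u, +oo[%classic).
    by rewrite -[X in measurable X]setTI; exact: mN.
  by apply/seteqP; split => w /=; rewrite in_itv/= andbT.
rewrite /confidence_sequence.
pose err n w := sq_err psi theta_star b Q (xs w) (ys w) n.
(* The failure event as strict inequalities in [sq_err], a form in which it is visibly
   measurable. *)
rewrite (_ : [set w | _] = [set w | exists n, (1 <= n)%N /\
    beta d s m M B Loo delta n < 2^-1 * err n w]); last first.
  apply/seteqP; split => w [n [n1 H]]; exists n; split => //.
    rewrite ltNge; apply/negP; apply: contra_not H => H.
    by rewrite /conf_set/=; under eq_bigr do rewrite fE.
  move=> /=; rewrite /conf_set/=; under eq_bigr do rewrite fE.
  by move: H; rewrite ltNge => /negP.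
(* Where the covariates are bounded the evidence bound applies, and failure forces the wealth to
   reach [delta^-1]. *)
apply: (ae_confidence (A := fun w => forall t, (1 <= t)%N -> norm_oo (X t w) <= Loo)
  (F := [set w | exists n, delta^-1 <= N n w])) => //.
- rewrite (_ : [set w | _] = \bigcup_(n in [set n | (1 <= n)%N])
      ((fun w => 2^-1 * err n w) @^-1` `](beta d s m M B Loo delta n), +oo[%classic)).
    apply: bigcup_measurable => n _; rewrite -[X in measurable X]setTI.
    have mS : measurable_fun setT (fun w => 2^-1 * err n w).
      apply: measurable_funM => //; apply: measurable_sq_err => // k _.
    exact: mS.
  apply/seteqP; split => w; first by move=> [n [n1 H]]; exists n => //=; rewrite in_itv/= andbT.
  by move=> [n n1 /=]; rewrite in_itv/= andbT => H; exists n.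
- rewrite (_ : [set w | _] = \bigcup_n [set w | delta^-1 <= N n w]).
    by apply: bigcupT_measurable => n; exact: mlt.
  by apply/seteqP; split => w [n]; [exists n|move=> _; exists n].
- move=> w xL [n [n1 H]]; exists n.
  have tS : #|supp theta_star| = s by exact: theta_star_sparse.
  apply: (half_sq_err_gt_beta (s := s) (d := d) (wt := subset_weight (supp theta_star))
    (r := Num.sqrt (1 + M * B ^+ 2 * Loo ^+ 2 * n%:R / 2))) => //.
  + rewrite sqrtr_gt0 ltr_wpDr// divr_ge0// !mulr_ge0 ?exprn_ge0// ltW//.
  + by rewrite -tS; apply: subset_weight_ge; rewrite tS.
  + exact/ltW/subset_weight_gt0.
  + rewrite -lee_fin evidenceE// QI; last 2 first.
    * by move=> u; rewrite lee_fin ltW// sqrt_lik_gt0.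
    * by apply/measurable_EFinP; exact: measurable_lik.
    by rewrite -tS; apply: prior_sqrt_lik_ge => // k /andP[k1 _]; exact: xL.
(* Ville's inequality at the threshold [delta^-1], for the wealth started at 1. *)
- rewrite -[in leRHS](invrK delta); apply: ville => //.
  + by rewrite invr_gt0.
  + by move=> n w; exact: wealth_ge0.
  + under eq_integral do rewrite /N wealth0//.
    by rewrite integral_cst// mul1e; exact: probability_le1.
  + move=> n; exact: (wealth_supermartingale _ d_gt0 mYcal nu_sigma_finite h_ge0
      psi_convex mpsi glm_densityP b_gt0 m_gt0 psi_smooth psi_strongly_convex Q1
      lik_lty Y_density theta_star_X_bounded n).
Qed.
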